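(* Let $X>0$, $c_0\in(0,1)$ and $\mu\in(0,\frac1{100})$. There is a constant $\beta>0$ depending only on $\mu,c_0,X$ such that, for every $\alpha_0\in(0,1)$ and $C_1>0$, with $b=\frac{c_0}{4}e^{-\beta X}e^{-8/3}$, the following holds for every steady (time-independent) Oleinik monotone solution $\bar u$ and every global Oleinik monotone solution $u$ of the Prandtl problem on $[0,+\infty)\times[0,X]\times[0,+\infty)$, with Crocco transforms $\bar w$ and $w$, such that $\partial_\eta^2\bar w\le0$ and both $\bar w$ and $w$ satisfy the data conditions with parameters $(c_0,\mu,\alpha_0,C_1,\beta)$. (i) Orbital stability: for any $\epsilon>0$ there exists $\delta_\epsilon>0$, depending only on $\epsilon,\mu,\alpha_0,c_0,C_1$ and $X$ (in particular not on $u,\bar u$), such that if $$\|\partial_yu_1-\partial_y\bar u_1\|_{L^\infty([0,+\infty)\times[0,+\infty))}\le\delta_\epsilon,\qquad \|\partial_yu_0-\partial_y\bar u_0\|_{L^\infty([0,X]\times[0,+\infty))}\le\delta_\epsilon,$$ then $$\|\bar u-u\|_{L^\infty([0,+\infty)\times[0,X]\times[0,+\infty))}\le\epsilon.$$ (ii) Asymptotic stability: if, for some constant $\beta_0\in(0,b^2\alpha_0(1-\alpha_0))$ and some constant $C_2>0$, $$\big|\partial_yu_1\big(t,u_1^{-1}(t,\eta)\big)-\partial_y\bar u_1\big(t,\bar u_1^{-1}(t,\eta)\big)\big|\le e^{-t\beta_0}C_2(1-\eta)^{\alpha_0},$$ where $u_1^{-1}(t,\eta)$ (resp. $\bar u_1^{-1}(t,\eta)$)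 is the $y$ such that $u_1(t,y)=\eta$ (resp. $\bar u_1(t,y)=\eta$), or equivalently $|w_1-\bar w_1|\le e^{-\tau\beta_0}C_2(1-\eta)^{\alpha_0}$, then for any $y_0>0$ there exists a constant $C>0$ depending on $y_0$ such that $$\|u(t,\cdot,\cdot)-\bar u\|_{L^\infty([0,X]\times[0,y_0])}\le Ce^{-t\beta_0}\quad\text{for all }t\in[0,+\infty).$$ Moreover, $$\|u(t,\cdot,\cdot)-\bar u\|_{L^\infty([0,X]\times[0,+\infty))}\to0\quad\text{as }t\to+\infty.$$
   Context: Prandtl problem (outer flow $U\equiv1$), for $(t,x,y)\in(0,+\infty)\times(0,X]\times(0,+\infty)$: $\partial_tu+u\,\partial_xu+v\,\partial_yu-\partial_y^2u=0$, $\partial_xu+\partial_yv=0$, $u|_{y=0}=v|_{y=0}=0$, $\lim_{y\to+\infty}u(t,x,y)=1$, $u|_{t=0}=u_0(x,y)$, $u|_{x=0}=u_1(t,y)$. For $\bar u$, the data are $\bar u_0,\bar u_1$. Crocco transform, under $\partial_yu>0$: $\tau=t$, $\xi=x$, $\eta=u(t,x,y)$, $w(\tau,\xi,\eta)=\partial_yu(t,x,y)$. It satisfies the Crocco problem in $D=(0,+\infty)\times(0,X]\times(0,1)$: $-\partial_\tau w-\eta\,\partial_\xi w+w^2\partial_\eta^2w=0$ in $D$; $w\,\partial_\eta w|_{\eta=0}=0$, $w|_{\eta=1}=0$; $w|_{\tau=0}=w_0(\xi,\eta)$, $w|_{\xi=0}=w_1(\tau,\eta)$. The quantities $\bar w,\bar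 w_0,\bar w_1$ are the ones associated with $\bar u$. $u$ is an Oleinik monotone solution if $\partial_yu>0$ and its Crocco transform $w$ is in $C^2([0,+\infty)\times[0,X]\times[0,1))\cap C^3((0,+\infty)\times(0,X]\times(0,1))$, solves the Crocco problem, and satisfies $\lim_{\eta\to1}\partial_\xi w=\lim_{\eta\to1}\partial_\tau w=0$ and $\lim_{\eta\to1}w\,\partial_\eta^2w=l(\tau,\xi)$ for some continuous $l$. Here $w,\partial_\xi w,\partial_\tau w$ are understood to extend continuously to $\eta=1$ with value $0$, and $w\partial_\eta^2w$ to extend continuously with value $l$. Data conditions with parameters $(c_0,\mu,\alpha_0,C_1,\beta)$: set $b=\frac{c_0}{4}e^{-\beta X}e^{-8/3}$, $K=e^X\max\{2,2C_1^{\frac1{\alpha_0}-1}\}$, $\delta=\min\{\frac1{10}\min_{\alpha\in[\alpha_0/2,\alpha_0]}\alpha(1-\alpha)b^2,\ \frac1{321e^X},\ \frac{\min\{1,C_1\}}{b2^{\alpha_0}}\}$. The conditions are: $c_0(1-\eta)\le w_i\le c_0^{-1}(1-\eta)\sqrt{-\ln(\mu(1-\eta))}$ for $i=0,1$; and, both on $\{\xi=0\}$ and on $\{\tau=0\}$, $-C_1(1-\eta)^{\alpha_0}\le\partial_\xi w+\partial_\tau w\le\frac{(\delta b)^{1/\alpha_0}}{K}(1-\eta)$ and $-C_1(1-\eta)^{\alpha_0}\le\partial_\tau w\le b\delta(1-\eta)^{\alpha_0}$. *)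

(* Defs.v *)
From HB Require Import structures.
From mathcomp Require Import all_boot all_order all_algebra.
From mathcomp Require Import all_classical all_reals all_analysis.
Set Implicit Arguments.
Unset Strict Implicit.
Unset Printing Implicit Defensive.
Import Order.TTheory GRing.Theory Num.Theory.
Import numFieldNormedType.Exports.
Local Open Scope classical_set_scope.
Local Open Scope ring_scope.

Section Calculus.
Variable R : realType.
Implicit Types (A B E : set R) (f : R -> R -> R -> R).

(* Derivative relative to A: one-sided at an endpoint of an interval that
   belongs to it, so that only the values of g on A matter. *)
Definition derivable_within A (g : R -> R) (a : R) : Prop :=
  cvg ((fun s => (g s - g a) / (s - a)) @ within A a^').

Definition derive_within A (g : R -> R) (a : R) : R :=
  lim ((fun s => (g s - g a) / (s - a)) @ within A a^').

(* The differentiated variable ranges over the given set. *)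
Definition pderiv1 A f : R -> R -> R -> R :=
  fun a b c => derive_within A (fun s => f s b c) a.
Definition pderiv2 B f : R -> R -> R -> R :=
  fun a b c => derive_within B (fun s => f a s c) b.
Definition pderiv3 E f : R -> R -> R -> R :=
  fun a b c => derive_within E (fun s => f a b s) c.

Definition uncurry3 f : R * R * R -> R := fun p => f p.1.1 p.1.2 p.2.

Definition continuous_box A B E f : Prop :=
  {within A `*` B `*` E, continuous (uncurry3 f)}.

Fixpoint Ck_box (k : nat) A B E f : Prop :=
  continuous_box A B E f /\
  match k with
  | 0 => True
  | k'.+1 =>
    [/\ forall a b c, A a -> B b -> E c ->
          [/\ derivable_within A (fun s => f s b c) a,
              derivable_within B (fun s => f a s c) b &
              derivable_within E (fun s => f a b s) c],
        Ck_box k' A B E (pderiv1 A f),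
        Ck_box k' A B E (pderiv2 B f) &
        Ck_box k' A B E (pderiv3 E f)]
  end.

(* L^oo norms over A x B and A x B x E (essential suprema for the Lebesgue
   measure) of functions extended by 0 outside of these sets. *)
Definition Linfty2 A B (g : R -> R -> R) : \bar R :=
  Lnorm (@lebesgue_measure R \x @lebesgue_measure R)%E +oo%E
    ((fun p : R * R => (g p.1 p.2)%:E) \_ (A `*` B)).

Definition Linfty3 A B E f : \bar R :=
  Lnorm ((@lebesgue_measure R \x @lebesgue_measure R) \x
         @lebesgue_measure R)%E +oo%E
    ((fun p : R * R * R => (uncurry3 f p)%:E) \_ (A `*` B `*` E)).

End Calculus.

Section Prandtl.
Variable R : realType.

Definition Rge0 : set R := `[0, +oo[.

(* The vertical velocity v is determined by u, and is existentially quantified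
   where u alone is called a solution. *)
Record prandtl_problem (X : R) (u0 u1 : R -> R -> R) (u v : R -> R -> R -> R) :
    Prop := PrandtlProblem {
  prandtl_u_cont : continuous_box Rge0 `[0, X] Rge0 u ;
  prandtl_v_cont : continuous_box Rge0 `[0, X] Rge0 v ;
  prandtl_derivable : forall t x y : R, 0 < t -> 0 < x <= X -> 0 < y ->
    derivable_within Rge0 (fun s => u s x y) t /\
    derivable_within `[0, X] (fun s => u t s y) x /\
    derivable_within Rge0 (u t x) y /\
    derivable_within Rge0 (pderiv3 Rge0 u t x) y /\
    derivable_within Rge0 (v t x) y ;
  prandtl_momentum : forall t x y : R, 0 < t -> 0 < x <= X -> 0 < y ->
    pderiv1 Rge0 u t x y + u t x y * pderiv2 `[0, X] u t x y
    + v t x y * pderiv3 Rge0 u t x y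
    - pderiv3 Rge0 (pderiv3 Rge0 u) t x y = 0 ;
  prandtl_div : forall t x y : R, 0 < t -> 0 < x <= X -> 0 < y ->
    pderiv2 `[0, X] u t x y + pderiv3 Rge0 v t x y = 0 ;
  prandtl_wall : forall t x : R, 0 <= t -> 0 <= x <= X ->
    u t x 0 = 0 /\ v t x 0 = 0 ;
  prandtl_outer : forall t x : R, 0 <= t -> 0 <= x <= X ->
    u t x y @[y --> +oo] --> (1 : R) ;
  prandtl_initial : forall x y : R, 0 <= x <= X -> 0 <= y -> u 0 x y = u0 x y ;
  prandtl_inflow : forall t y : R, 0 <= t -> 0 <= y -> u t 0 y = u1 t y
}.

(* y |-> u t x y is, for the solutions considered, a bijection from [0, +oo)
   onto [0, 1), so this determines w for eta in [0, 1). *)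
Definition is_crocco_transform (X : R) (u w : R -> R -> R -> R) : Prop :=
  forall t x y : R, 0 <= t -> 0 <= x <= X -> 0 <= y ->
    w t x (u t x y) = pderiv3 Rge0 u t x y.

Record crocco_problem (X : R) (w0 w1 : R -> R -> R) (w : R -> R -> R -> R) :
    Prop := CroccoProblem {
  crocco_eq : forall t x e : R, 0 < t -> 0 < x <= X -> 0 < e < 1 ->
    - pderiv1 Rge0 w t x e - e * pderiv2 `[0, X] w t x e
    + w t x e ^+ 2 * pderiv3 `[0, 1[ (pderiv3 `[0, 1[ w) t x e = 0 ;
  crocco_wall : forall t x : R, 0 <= t -> 0 <= x <= X ->
    w t x 0 * pderiv3 `[0, 1[ w t x 0 = 0 ;
  crocco_outer : forall t x : R, 0 <= t -> 0 <= x <= X -> w t x 1 = 0 ;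
  crocco_initial : forall x e : R, 0 <= x <= X -> 0 <= e <= 1 ->
    w 0 x e = w0 x e ;
  crocco_inflow : forall t e : R, 0 <= t -> 0 <= e <= 1 -> w t 0 e = w1 t e
}.

(* f, given on [0, +oo) x [0, X] x [0, 1), extends continuously to eta = 1
   with value l there. *)
Definition extends_at_eta1 (X : R) (f : R -> R -> R -> R) (l : R -> R -> R) :
    Prop :=
  forall t x : R, 0 <= t -> 0 <= x <= X ->
    uncurry3 f @ within (Rge0 `*` `[0, X] `*` `[0, 1[)
                   (nbhs ((t, x, 1) : R * R * R))
      --> l t x.

Record oleinik_solution (X : R) (u0 u1 : R -> R -> R) (u : R -> R -> R -> R)
    (w0 w1 : R -> R -> R) (w : R -> R -> R -> R) : Prop := OleinikSolution {
  oleinik_prandtl : exists v, prandtl_problem X u0 u1 u v ;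
  oleinik_monotone : forall t x y : R, 0 <= t -> 0 <= x <= X -> 0 <= y ->
    derivable_within Rge0 (u t x) y /\ 0 < pderiv3 Rge0 u t x y ;
  oleinik_transform : is_crocco_transform X u w ;
  oleinik_C2 : Ck_box 2 Rge0 `[0, X] `[0, 1[ w ;
  oleinik_C3 : Ck_box 3 `]0, +oo[ `]0, X] `]0, 1[ w ;
  oleinik_crocco : crocco_problem X w0 w1 w ;
  oleinik_w_eta1 : extends_at_eta1 X w (fun _ _ => 0) ;
  oleinik_dxi_eta1 : extends_at_eta1 X (pderiv2 `[0, X] w) (fun _ _ => 0) ;
  oleinik_dtau_eta1 : extends_at_eta1 X (pderiv1 Rge0 w) (fun _ _ => 0) ;
  oleinik_deta2_eta1 : exists l : R -> R -> R,
    {within Rge0 `*` `[0, X], continuous (fun p : R * R => l p.1 p.2)} /\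
    extends_at_eta1 X
      (fun t x e => w t x e * pderiv3 `[0, 1[ (pderiv3 `[0, 1[ w) t x e) l
}.

Definition bconst (X c0 beta : R) : R :=
  c0 / 4 * expR (- (beta * X)) * expR (- (8 / 3)).

Definition Kconst (X alpha0 C1 : R) : R :=
  expR X * Num.max 2 (2 * C1 `^ (alpha0^-1 - 1)).

Definition deltaconst (X c0 alpha0 C1 beta : R) : R :=
  let b := bconst X c0 beta in
  Num.min
    (10^-1 * inf [set a * (1 - a) * b ^+ 2 | a in `[alpha0 / 2, alpha0]])
    (Num.min (321 * expR X)^-1 (Num.min 1 C1 / (b * 2 `^ alpha0))).

Definition data_bounds (c0 mu e z : R) : Prop :=
  c0 * (1 - e) <= z <= c0^-1 * (1 - e) * Num.sqrt (- ln (mu * (1 - e))).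

Record data_conditions (X c0 mu alpha0 C1 beta : R)
    (w0 w1 : R -> R -> R) (w : R -> R -> R -> R) : Prop :=
  DataConditions {
  data_w0 : forall x e : R, 0 <= x <= X -> 0 <= e < 1 ->
    data_bounds c0 mu e (w0 x e) ;
  data_w1 : forall t e : R, 0 <= t -> 0 <= e < 1 ->
    data_bounds c0 mu e (w1 t e) ;
  data_derivatives : forall t x e : R, 0 <= t -> 0 <= x <= X -> 0 <= e < 1 ->
    x = 0 \/ t = 0 ->
    let b := bconst X c0 beta in
    let K := Kconst X alpha0 C1 in
    let delta := deltaconst X c0 alpha0 C1 beta in
    let wtau := pderiv1 Rge0 w t x e in
    let wxi := pderiv2 `[0, X] w t x e in
    - C1 * (1 - e) `^ alpha0 <= wxi + wtau
      <= (delta * b) `^ alpha0^-1 / K * (1 - e) /\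
    - C1 * (1 - e) `^ alpha0 <= wtau <= b * delta * (1 - e) `^ alpha0
}.

(* A steady flow is given by its profile ubar (x, y), and is an unsteady flow
   that does not depend on t. *)
Record stability_setting (X c0 mu alpha0 C1 beta : R)
    (ubar0 ubar1 ubar wbar0 wbar1 : R -> R -> R) (wbar : R -> R -> R -> R)
    (u0 u1 : R -> R -> R) (u : R -> R -> R -> R)
    (w0 w1 : R -> R -> R) (w : R -> R -> R -> R) : Prop := StabilitySetting {
  setting_steady : oleinik_solution X ubar0 ubar1 (fun _ => ubar)
                     wbar0 wbar1 wbar ;
  setting_unsteady : oleinik_solution X u0 u1 u w0 w1 w ;
  setting_concave : forall t x e : R, 0 <= t -> 0 <= x <= X -> 0 <= e < 1 ->
    pderiv3 `[0, 1[ (pderiv3 `[0, 1[ wbar) t x e <= 0 ;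
  setting_steady_data : data_conditions X c0 mu alpha0 C1 beta
    wbar0 wbar1 wbar ;
  setting_unsteady_data : data_conditions X c0 mu alpha0 C1 beta w0 w1 w
}.

Definition dy (g : R -> R -> R) : R -> R -> R :=
  fun s y => derive_within Rge0 (g s) y.

Definition yinv (g : R -> R -> R) (s eta : R) : R :=
  get [set y | 0 <= y /\ g s y = eta].

End Prandtl.
Arguments Rge0 {R}.

(* Main.v *)
Require Import Defs.
From mathcomp Require Import all_boot all_order all_algebra.
From mathcomp Require Import all_classical all_reals all_analysis.
From mathcomp Require Import ring lra ess_sup_inf.
Set Implicit Arguments.
Unset Strict Implicit.
Unset Printing Implicit Defensive.
Import Order.TTheory GRing.Theory Num.Theory.
Import numFieldNormedType.Exports.
Local Open Scope classical_set_scope.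
Local Open Scope ring_scope.

(** Strategy. In the Crocco variables the solutions satisfy
    w_t + eta w_xi = w^2 w_{eta eta}, a degenerate parabolic equation in which
    t and xi are both time-like. Everything rests on comparison principles for
    this equation on the compact boxes [0, T] x [0, X] x [0, 1]
    ([parabolic_comparison]): a function that is nonpositive on the faces
    t = 0, xi = 0, eta = 1 and increasing in eta at the wall cannot have a
    positive maximum where its derivatives contradict the equation.

    A first comparison, with c0 e^(-20 xi) times an explicit cubic in eta, gives
    w >= b (1 - eta) ([crocco_lower_bound], [bconst_lower]); any sufficiently
    large rate can take the place of 20, which is the value chosen for beta.

    A second comparison controls phi = w - wbar, which solves
    phi_t + eta phi_xi = w^2 phi_{eta eta} + (w + wbar) wbar_{eta eta} phi.
    Since wbar is concave in eta, the zeroth order term has the good sign for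
    phi and for -phi, and nonnegative supersolutions of the principal part
    bound |phi|
    ([crocco_difference_bound]). A constant gives |phi| <= sup of the boundary
    values ([crocco_difference_sup]); the function
    C e^(-beta0 t) (1 - eta)^alpha0 is a supersolution because
    w^2 >= b^2 (1 - eta)^2 and beta0 < b^2 alpha0 (1 - alpha0)
    ([crocco_difference_decay]).

    To return to the velocities, u(t, x, .) solves the autonomous equation
    u_y = w(t, x, u). Concavity and wbar_eta = 0 at the wall make wbar
    nonincreasing in eta, so the difference of two profiles grows at most like
    y sup |w - wbar| ([profile_difference]); the lower bound of w gives
    1 - u <= e^(-b y) ([outer_flow_tail]), which takes care of large y
    ([profile_difference_uniform]).

    In the orbital stability statement the data are close as functions of y
    rather than of eta. A concave positive wbar is Lipschitz away from
    eta = 1, and both transforms are small near eta = 1 by the data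
    conditions, so that closeness of the shears in y implies closeness of the
    transforms in eta ([crocco_close_of_shear_close]). *)

(** * One-sided derivatives *)

(** A relational form of [derive_within], stable under the algebraic rules
    below at endpoints as well as at interior points. *)
Definition has_derive {R : realType} (A : set R) (g : R -> R) (a l : R) :
    Prop :=
  (fun s => (g s - g a) / (s - a)) @ within A a^' --> l.

Section OneSided.
Context {R : realType}.
Implicit Types (A : set R) (g f : R -> R) (a l d e s : R).

Lemma derivable_within_has_derive A g a :
  derivable_within A g a -> has_derive A g a (derive_within A g a).
Proof. by []. Qed.

Lemma has_deriveP A g a l : has_derive A g a l -> forall e, 0 < e ->
  exists2 d, 0 < d & forall s, A s -> s != a -> `|s - a| < d ->
    `|(g s - g a) / (s - a) - l| < e.
Proof.
move=> /cvgrPdist_lt H e e0; have := H e e0.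
rewrite /within /= => -[d /= d0 Hd]; exists d => // s As sa sd.
by rewrite distrC; apply: Hd => //=; rewrite distrC.
Qed.

Lemma has_derive_left_ge0 A g a l d : has_derive A g a l -> 0 < d ->
  (forall s, a - d < s < a -> A s /\ g s <= g a) -> 0 <= l.
Proof.
move=> H d0 Hs; rewrite leNgt; apply/negP => l0.
have [d1 d10 Hd] := has_deriveP H (ltac:(lra) : 0 < - l).
pose s := a - Num.min d d1 / 2.
have m0 : 0 < Num.min d d1 by rewrite lt_min d0.
have md : Num.min d d1 <= d by rewrite ge_min lexx.
have md1 : Num.min d d1 <= d1 by rewrite ge_min lexx orbT.
have sa : s < a by rewrite /s; lra.
have [As gs] := Hs s ltac:(rewrite /s; lra).
have := Hd s As (ltac:(rewrite lt_eqF//)) (ltac:(rewrite ltr0_norm /s; lra)).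
have q : 0 <= (g s - g a) / (s - a) by rewrite -divrNN divr_ge0; lra.
rewrite ger0_norm; lra.
Qed.

Lemma has_derive_right_le0 A g a l d : has_derive A g a l -> 0 < d ->
  (forall s, a < s < a + d -> A s /\ g s <= g a) -> l <= 0.
Proof.
move=> H d0 Hs; rewrite leNgt; apply/negP => l0.
have [d1 d10 Hd] := has_deriveP H l0.
pose s := a + Num.min d d1 / 2.
have m0 : 0 < Num.min d d1 by rewrite lt_min d0.
have md : Num.min d d1 <= d by rewrite ge_min lexx.
have md1 : Num.min d d1 <= d1 by rewrite ge_min lexx orbT.
have sa : a < s by rewrite /s; lra.
have [As gs] := Hs s ltac:(rewrite /s; lra).
have := Hd s As (ltac:(rewrite gt_eqF//)) (ltac:(rewrite gtr0_norm /s; lra)).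
have q : (g s - g a) / (s - a) <= 0 by rewrite ler_pdivrMr; lra.
rewrite ler0_norm; lra.
Qed.

Lemma has_derive_continuous A g a l : has_derive A g a l ->
  g @ within A (nbhs a) --> g a.
Proof.
move=> H; have [d d0 Hd] := has_deriveP H ltr01.
apply/cvgrPdist_lt => e e0.
have L0 : 0 < `|l| + 1 by rewrite ltr_wpDl.
exists (Num.min d (e / (`|l| + 1))); first by rewrite /= lt_min d0 divr_gt0.
move=> s /=; rewrite lt_min distrC => /andP[sd se] As; rewrite distrC.
have [->|sa] := eqVneq s a; first by rewrite subrr normr0.
have Hq : `|(g s - g a) / (s - a)| <= `|l| + 1.
  rewrite -[X in `|X|](subrK l) addrC (le_trans (ler_normD _ _))// lerD2l.
  exact/ltW/Hd.
rewrite -[g s - g a](divfK (x := s - a)) ?subr_eq0// normrM.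
by rewrite (le_lt_trans (ler_wpM2r _ Hq))// mulrC -ltr_pdivlMr.
Qed.

Lemma has_deriveB A f g a l m : has_derive A f a l -> has_derive A g a m ->
  has_derive A (fun s => f s - g s) a (l - m).
Proof.
move=> Hf Hg; rewrite /has_derive.
rewrite (_ : (fun s => _) = (fun s =>
  (f s - f a) / (s - a) - (g s - g a) / (s - a))).
  exact: cvgB.
by apply/funext => s; rewrite -mulrBl; congr (_ / _); ring.
Qed.

Lemma is_derive_has_derive A g a l : is_derive a 1 g l -> has_derive A g a l.
Proof.
move=> /is_derive1_caratheodory[k [gE kc ka]]; rewrite /has_derive -ka.
apply/cvgrPdist_lt => e e0.
have /cvgrPdist_lt /(_ _ e0)[d /= d0 Hd] := kc.
exists d => //= s sd sa As; rewrite gE mulfK ?subr_eq0//; exact: Hd.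
Qed.

Lemma has_derive_cst A (k x : R) : has_derive A (fun=> k) x 0.
Proof. by apply: is_derive_has_derive; exact: is_derive_cst. Qed.

Lemma is_derive_expR_lin (k x : R) :
  is_derive x 1 (fun s => expR (k * s)) (k * expR (k * x)).
Proof.
rewrite mulrC; apply: (@is_derive1_comp R expR ( *%R k)).
have := @is_deriveZ _ R R id k x 1 1 (is_derive_id x 1).
by rewrite /GRing.scale/= mulr1.
Qed.

Lemma is_derive_scale (k : R) f (x l : R) :
  is_derive x 1 f l -> is_derive x 1 (fun s => k * f s) (k * l).
Proof. exact: (@is_deriveZ _ R R f k x 1 l). Qed.

Lemma has_derive_lin A (k x : R) : has_derive A (fun s => k * s) x k.
Proof.
apply: is_derive_has_derive; rewrite -[X in is_derive _ _ _ X]mulr1.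
exact: (@is_deriveZ _ R R id k x 1 1).
Qed.

(** Otherwise psi - k (s - a), for small k > 0, has a positive maximum, at which
    psi is positive and has derivative at least k. *)
Lemma growth_nonpos A (psi dpsi : R -> R) a Y : a <= Y ->
  (forall s, a <= s <= Y -> A s) ->
  (forall s, a <= s <= Y -> has_derive A psi s (dpsi s)) ->
  psi a <= 0 -> (forall s, a < s <= Y -> 0 < psi s -> dpsi s <= 0) ->
  psi Y <= 0.
Proof.
move=> aY AY dpsiE psia Hneg; rewrite leNgt; apply/negP => psiY.
have {}aY : a < Y.
  by rewrite lt_neqAle aY andbT; apply/eqP => aE; move: psiY; rewrite -aE; lra.
pose k := psi Y / (2 * (Y - a)).
have k0 : 0 < k by rewrite divr_gt0; lra.
have kY : k * (Y - a) = psi Y / 2 by rewrite /k; field; lra.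
pose chi := fun s => psi s - (k * s - k * a).
have dchi s : a <= s <= Y -> has_derive A chi s (dpsi s - k).
  move=> sY; apply: has_deriveB; first exact: dpsiE.
  by rewrite -[X in has_derive _ _ _ X]subr0;
    apply: (has_deriveB (@has_derive_lin _ _ _));
    exact: has_derive_cst.
have [] := @EVT_max R chi a Y (ltW aY).
  apply/subspace_continuousP => s /=; rewrite in_itv/= => sY.
  apply: cvg_trans (has_derive_continuous (dchi s sY)).
  apply: cvg_app; apply: within_subset => z /=; rewrite in_itv/=; exact: AY.
move=> c; rewrite in_itv/= => cY cmax.
have := cmax Y; rewrite in_itv/= lexx ltW// => /(_ isT) chiY.
have chic : 0 < chi c by apply: lt_le_trans chiY; rewrite /chi; lra.
have ac : a < c.
  rewrite lt_neqAle; case/andP: (cY) => -> _; rewrite andbT.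
  by apply/eqP => ac; move: chic; rewrite /chi -ac; lra.
have psic : 0 < psi c.
  move: chic; rewrite /chi.
  have : 0 < k * (c - a) by rewrite mulr_gt0//; lra.
  lra.
have := Hneg c ltac:(lra) psic.
suff : 0 <= dpsi c - k by lra.
apply: (has_derive_left_ge0 (d := c - a) (dchi c cY)); first lra.
move=> s sc; split; first by apply: AY; lra.
by apply: cmax; rewrite in_itv/=; lra.
Qed.

Lemma has_derive_max_eq0 A g a l d : has_derive A g a l -> 0 < d ->
  (forall s, a - d < s < a + d -> A s /\ g s <= g a) -> l = 0.
Proof.
move=> H d0 Hs; apply/eqP; rewrite eq_le; apply/andP; split.
  by apply: (has_derive_right_le0 H d0) => s sa; apply: Hs; lra.
by apply: (has_derive_left_ge0 H d0) => s sa; apply: Hs; lra.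
Qed.

(** If l > 0 then g' > 0 just to the right of a, so that g >= g a there by
    [growth_nonpos]; being bounded by g a, it is constant, which contradicts
    g' > 0. *)
Lemma second_derivative_max A g dg a l d : 0 < d ->
  (forall s, a - d < s < a + d ->
    [/\ A s, has_derive A g s (dg s) & g s <= g a]) ->
  has_derive A dg a l -> l <= 0.
Proof.
move=> d0 Hd H; rewrite leNgt; apply/negP => l0.
have dga : dg a = 0.
  have [_ Ha _] := Hd a ltac:(lra).
  by apply: (has_derive_max_eq0 Ha d0) => s /Hd[].
have [d1 d10 Hd1] := has_deriveP H l0.
pose m := Num.min d d1.
have m0 : 0 < m by rewrite lt_min d0.
have md : m <= d by rewrite ge_min lexx.
have md1 : m <= d1 by rewrite ge_min lexx orbT.
have dgpos s : a < s < a + m -> 0 < dg s.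
  move=> sa; have [As _ _] := Hd s ltac:(lra).
  have := Hd1 s As (ltac:(rewrite gt_eqF//; lra))
    (ltac:(rewrite gtr0_norm; lra)).
  rewrite dga subr0 ltr_norml => /andP[+ _].
  move=> q; have sa0 : 0 < s - a by lra.
  rewrite -[dg s](divfK (x := s - a)); last by rewrite gt_eqF.
  by rewrite mulr_gt0//; lra.
have gE s : a < s < a + m -> g s = g a.
  move=> sa; apply/eqP; rewrite eq_le; apply/andP; split.
    by have [] := Hd s ltac:(lra).
  rewrite -subr_le0.
  apply: (@growth_nonpos A (fun z => g a - g z) (fun z => 0 - dg z) a s).
  - lra.
  - by move=> z za; have [] := Hd z ltac:(lra).
  - move=> z za; apply: has_deriveB; last by have [] := Hd z ltac:(lra).
    by apply: is_derive_has_derive; exact: is_derive_cst.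
  - by rewrite subrr.
  - by move=> z za _; have := dgpos z ltac:(lra); lra.
pose s := a + m / 2.
have [_ Hs _] := Hd s ltac:(rewrite /s; lra).
have := dgpos s ltac:(rewrite /s; lra).
suff -> : dg s = 0 by rewrite ltxx.
apply: (has_derive_max_eq0 Hs (d := m / 2)); first lra.
move=> z; rewrite /s => za; have [Az _ _] := Hd z ltac:(lra).
by split=> //; rewrite !gE//; lra.
Qed.

End OneSided.

(** * Continuity on boxes *)

Section Box.
Context {R : realType}.
Implicit Types (A B E : set R) (f g : R -> R -> R -> R).

Lemma cvg_boxP A B E f (t x e l : R) :
  uncurry3 f @ within (A `*` B `*` E) (nbhs ((t, x, e) : R * R * R)) --> l <->
  forall eps : R, 0 < eps -> exists2 d : R, 0 < d &
    forall t' x' e' : R, A t' -> B x' -> E e' ->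
    `|t' - t| < d -> `|x' - x| < d -> `|e' - e| < d ->
    `|f t' x' e' - l| < eps.
Proof.
split=> [/cvgrPdist_lt H eps eps0|H].
  have := H eps eps0; rewrite /within /= => /nbhs_ballP[d /= d0 Hd].
  exists d => // t' x' e' At Bx Ee td xd ed; rewrite distrC.
  apply: (Hd (t', x', e')) => //.
  by split => /=; [split|]; rewrite /ball/= distrC.
apply/cvgrPdist_lt => eps eps0; have [d d0 Hd] := H _ eps0.
rewrite /within /=; apply/nbhs_ballP; exists d => //=.
move=> [[t' x'] e'] [[/= td xd] ed] [[/= At Bx] Ee].
by rewrite distrC; apply: Hd => //; rewrite distrC.
Qed.

Lemma continuous_boxP A B E f : continuous_box A B E f <->
  forall t x e : R, A t -> B x -> E e ->
  forall eps : R, 0 < eps -> exists2 d : R, 0 < d &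
    forall t' x' e' : R, A t' -> B x' -> E e' ->
    `|t' - t| < d -> `|x' - x| < d -> `|e' - e| < d ->
    `|f t' x' e' - f t x e| < eps.
Proof.
split=> [/subspace_continuousP H t x e At Bx Ee|H].
  by apply/cvg_boxP; exact: (H (t, x, e)).
by apply/subspace_continuousP => -[[t x] e] [[/= At Bx] Ee]; apply/cvg_boxP/H.
Qed.

Lemma continuous_box_sub A B E A' B' E' f :
  A' `<=` A -> B' `<=` B -> E' `<=` E ->
  continuous_box A B E f -> continuous_box A' B' E' f.
Proof.
move=> AA BB EE /continuous_boxP H;
  apply/continuous_boxP => t x e At Bx Ee eps eps0.
have [d d0 Hd] := H t x e (AA _ At) (BB _ Bx) (EE _ Ee) eps eps0.
by exists d => // *; apply: Hd => //; auto.
Qed.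

Lemma continuous_boxB A B E f g :
  continuous_box A B E f -> continuous_box A B E g ->
  continuous_box A B E (fun t x e => f t x e - g t x e).
Proof.
move=> /continuous_boxP Hf /continuous_boxP Hg; apply/continuous_boxP.
move=> t x e At Bx Ee eps eps0; have e2 : 0 < eps / 2 by lra.
have [d1 d10 H1] := Hf t x e At Bx Ee _ e2.
have [d2 d20 H2] := Hg t x e At Bx Ee _ e2.
exists (Num.min d1 d2); first by rewrite lt_min d10.
move=> t' x' e' At' Bx' Ee'; rewrite !lt_min.
move=> /andP[t1 t2] /andP[x1 x2] /andP[e1 e2'].
have := H1 _ _ _ At' Bx' Ee' t1 x1 e1; have := H2 _ _ _ At' Bx' Ee' t2 x2 e2'.
rewrite !ltr_norml; lra.
Qed.

Lemma continuous_boxT A B E (F : R * R * R -> R) :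
  continuous F -> continuous_box A B E (fun t x e => F (t, x, e)).
Proof.
move=> Fc; apply: continuous_subspaceT.
by rewrite (_ : uncurry3 _ = F)//; apply/funext => -[[]].
Qed.

End Box.

(** * The parabolic comparison principle *)

Section Parabolic.
Context {R : realType}.
Implicit Types (t x e T X : R).

(** At a positive maximum, t > 0, x > 0 and eta < 1. The maximum may lie on the
    faces t = T and x = X, where only left derivatives have a sign; these are
    the ones for which the sign is known. *)
Lemma parabolic_comparison T X (h ht hx he hee : R -> R -> R -> R) :
  continuous_box `[0, T] `[0, X] `[0, 1] h ->
  (forall t x e, 0 < t -> 0 < x <= X -> 0 <= e < 1 ->
     [/\ has_derive Rge0 (fun s => h s x e) t (ht t x e),
         has_derive `[0, X] (fun s => h t s e) x (hx t x e),
         has_derive `[0, 1[ (h t x) e (he t x e) &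
         has_derive `[0, 1[ (he t x) e (hee t x e)]) ->
  (forall t x e, 0 <= t <= T -> 0 <= x <= X -> 0 <= e <= 1 ->
     t = 0 \/ x = 0 \/ e = 1 -> h t x e <= 0) ->
  (forall t x, 0 < t -> 0 < x <= X -> 0 < he t x 0) ->
  (forall t x e, 0 < t -> 0 < x <= X -> 0 < e < 1 -> 0 < h t x e ->
     0 <= ht t x e -> 0 <= hx t x e -> hee t x e <= 0 -> False) ->
  forall t x e, 0 <= t <= T -> 0 <= x <= X -> 0 <= e <= 1 -> h t x e <= 0.
Proof.
move=> hcont hder hbd hwall hint t0 x0 e0 t0T x0X e01.
rewrite leNgt; apply/negP => h0.
have [] := @compact_EVT_max _ R (uncurry3 h) (`[0, T] `*` `[0, X] `*` `[0, 1]).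
- by exists (t0, x0, e0); rewrite /= !in_itv.
- by apply: compact_setX; [apply: compact_setX|]; exact: segment_compact.
- exact: hcont.
move=> [[t x] e]; rewrite inE /= !in_itv/= => -[[tT xX] eI] hmax.
have {}hmax t' x' e' : 0 <= t' <= T -> 0 <= x' <= X -> 0 <= e' <= 1 ->
    h t' x' e' <= h t x e.
  by move=> *; apply: (hmax (t', x', e')); rewrite inE /= !in_itv.
have hpos : 0 < h t x e by apply: lt_le_trans (hmax _ _ _ t0T x0X e01).
have neq : ~ (t = 0 \/ x = 0 \/ e = 1).
  by move=> /(hbd _ _ _ tT xX eI); rewrite leNgt hpos.
have tp : 0 < t.
  by rewrite lt_neqAle eq_sym; case/andP: tT => -> _; rewrite andbT;
    apply/eqP; tauto.
have xp : 0 < x.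
  by rewrite lt_neqAle eq_sym; case/andP: xX => -> _; rewrite andbT;
    apply/eqP; tauto.
have e1 : e < 1.
  by rewrite lt_neqAle; case/andP: eI => _ ->; rewrite andbT; apply/eqP; tauto.
have [Dt Dx De Dee] := hder t x e tp ltac:(lra) ltac:(lra).
have [e_0|e_0] := eqVneq e 0.
  have := hwall t x tp ltac:(lra); rewrite e_0 in De hmax.
  suff : he t x 0 <= 0 by lra.
  apply: (has_derive_right_le0 De ltr01) => s; rewrite add0r => s1.
  by rewrite /= in_itv/=; split; [lra|apply: hmax => //; lra].
have ep : 0 < e by rewrite lt_neqAle eq_sym e_0; case/andP: eI.
apply: (hint t x e tp _ _ hpos); [lra|lra|..].
- apply: (has_derive_left_ge0 Dt tp) => s; rewrite subrr => st.
  by rewrite /Rge0/= in_itv/= andbT; split; [lra|apply: hmax => //; lra].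
- apply: (has_derive_left_ge0 Dx xp) => s; rewrite subrr => st.
  by rewrite /= in_itv/=; split; [lra|apply: hmax => //; lra].
- have m0 : 0 < Num.min e (1 - e) by rewrite lt_min ep subr_gt0.
  apply: (second_derivative_max (g := h t x) m0 _ Dee) => s.
  have me : Num.min e (1 - e) <= e by rewrite ge_min lexx.
  have me1 : Num.min e (1 - e) <= 1 - e by rewrite ge_min lexx orbT.
  move=> se; have s01 : 0 <= s < 1 by lra.
  have xX0 : 0 < x <= X by lra.
  split.
  + by rewrite /= in_itv/=.
  + by have [] := hder t x s tp xX0 s01.
  + by apply: hmax => //; lra.
Qed.

(** What the comparison arguments use of a Crocco transform. Continuity is
    required up to eta = 1, for maxima over closed boxes to exist, whereas the
    equation and the derivatives only make sense for eta < 1. *)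
Record positive_crocco_solution X (w : R -> R -> R -> R) : Prop := {
  pcs_dt : forall t x e, 0 <= t -> 0 <= x <= X -> 0 <= e < 1 ->
    has_derive Rge0 (fun s => w s x e) t (pderiv1 Rge0 w t x e) ;
  pcs_dx : forall t x e, 0 <= t -> 0 <= x <= X -> 0 <= e < 1 ->
    has_derive `[0, X] (fun s => w t s e) x (pderiv2 `[0, X] w t x e) ;
  pcs_de : forall t x e, 0 <= t -> 0 <= x <= X -> 0 <= e < 1 ->
    has_derive `[0, 1[ (w t x) e (pderiv3 `[0, 1[ w t x e) ;
  pcs_dee : forall t x e, 0 <= t -> 0 <= x <= X -> 0 <= e < 1 ->
    has_derive `[0, 1[ (pderiv3 `[0, 1[ w t x) e
      (pderiv3 `[0, 1[ (pderiv3 `[0, 1[ w) t x e) ;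
  pcs_eq : forall t x e, 0 < t -> 0 < x <= X -> 0 < e < 1 ->
    pderiv1 Rge0 w t x e + e * pderiv2 `[0, X] w t x e =
    w t x e ^+ 2 * pderiv3 `[0, 1[ (pderiv3 `[0, 1[ w) t x e ;
  pcs_wall : forall t x, 0 <= t -> 0 <= x <= X -> pderiv3 `[0, 1[ w t x 0 = 0 ;
  pcs_outer : forall t x, 0 <= t -> 0 <= x <= X -> w t x 1 = 0 ;
  pcs_gt0 : forall t x e, 0 <= t -> 0 <= x <= X -> 0 <= e < 1 -> 0 < w t x e ;
  pcs_cont : continuous_box Rge0 `[0, X] `[0, 1] w
}.

End Parabolic.

Section Profile.
Context {R : realType} (X : R).
Context (u0 u1 : R -> R -> R) (u : R -> R -> R -> R) (w0 w1 : R -> R -> R)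
  (w : R -> R -> R -> R).
Implicit Types (t x y z e s : R).
Context (OS : oleinik_solution X u0 u1 u w0 w1 w).

Lemma oleinik_u_ode t x y : 0 <= t -> 0 <= x <= X -> 0 <= y ->
  has_derive Rge0 (u t x) y (w t x (u t x y)).
Proof.
move=> t0 xX y0; have [D _] := oleinik_monotone OS t0 xX y0.
by rewrite (oleinik_transform OS t0 xX y0);
  exact: derivable_within_has_derive D.
Qed.

Lemma oleinik_w_u_gt0 t x y : 0 <= t -> 0 <= x <= X -> 0 <= y ->
  0 < w t x (u t x y).
Proof.
move=> t0 xX y0; rewrite (oleinik_transform OS t0 xX y0).
by have [] := oleinik_monotone OS t0 xX y0.
Qed.

Lemma oleinik_u_wall t x : 0 <= t -> 0 <= x <= X -> u t x 0 = 0.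
Proof.
by move=> t0 xX; have [v /prandtl_wall P] := oleinik_prandtl OS;
  have [] := P t x t0 xX.
Qed.

Lemma oleinik_u_homo t x y z : 0 <= t -> 0 <= x <= X -> 0 <= y <= z ->
  u t x y <= u t x z.
Proof.
move=> t0 xX yz; rewrite -subr_le0.
apply: (@growth_nonpos _ Rge0 (fun s => u t x y - u t x s)
  (fun s => 0 - w t x (u t x s)) y z).
- lra.
- by move=> s ys; rewrite /Rge0 /= in_itv/= andbT; lra.
- move=> s ys; apply: has_deriveB; last by apply: oleinik_u_ode => //; lra.
  by apply: is_derive_has_derive; exact: is_derive_cst.
- by rewrite subrr.
- by move=> s ys _; have := oleinik_w_u_gt0 (y := s) t0 xX ltac:(lra); lra.
Qed.

Lemma oleinik_u_ge0 t x y : 0 <= t -> 0 <= x <= X -> 0 <= y -> 0 <= u t x y.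
Proof.
move=> t0 xX y0; rewrite -(oleinik_u_wall t0 xX).
by apply: oleinik_u_homo => //; rewrite lexx.
Qed.

Lemma oleinik_u_cvg1 t x : 0 <= t -> 0 <= x <= X ->
  u t x y @[y --> +oo] --> (1 : R).
Proof.
by move=> t0 xX; have [v P] := oleinik_prandtl OS; exact: (prandtl_outer P).
Qed.

Lemma oleinik_u_le1 t x y : 0 <= t -> 0 <= x <= X -> 0 <= y -> u t x y <= 1.
Proof.
move=> t0 xX y0; rewrite leNgt; apply/negP => ugt.
have /cvgrPdist_lt := oleinik_u_cvg1 t0 xX.
move=> /(_ (u t x y - 1) ltac:(lra)) [M [_ HM]].
have := HM (Num.max (M + 1) y) ltac:(by rewrite lt_max; apply/orP; left; lra).
rewrite ltr_norml => /andP[+ _].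
have := @oleinik_u_homo t x y (Num.max (M + 1) y) t0 xX.
rewrite y0 le_max lexx orbT => /(_ isT); lra.
Qed.

(** At a point where u = 1 the profile is maximal, so u_y <= 0 there. *)
Lemma oleinik_u_lt1 t x y : 0 <= t -> 0 <= x <= X -> 0 <= y -> u t x y < 1.
Proof.
move=> t0 xX y0; rewrite ltNge; apply/negP => ugt.
have := oleinik_w_u_gt0 t0 xX y0.
suff : w t x (u t x y) <= 0 by lra.
apply: (has_derive_right_le0 (oleinik_u_ode t0 xX y0) ltr01) => s ys.
split; first by rewrite /Rge0 /= in_itv/= andbT; lra.
by apply: le_trans ugt; apply: oleinik_u_le1 => //; lra.
Qed.

Lemma oleinik_u_onto t x e : 0 <= t -> 0 <= x <= X -> 0 <= e < 1 ->
  exists2 y, 0 <= y & u t x y = e.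
Proof.
move=> t0 xX e01.
have /cvgrPdist_lt := oleinik_u_cvg1 t0 xX.
move=> /(_ (1 - e) ltac:(lra)) [M [_ HM]].
pose Y := Num.max (M + 1) 0.
have Y0 : 0 <= Y by rewrite le_max lexx orbT.
have := HM Y ltac:(by rewrite lt_max; apply/orP; left; lra).
rewrite ltr_norml => /andP[_ uY].
have [] := @IVT R (u t x) 0 Y e Y0.
- apply/subspace_continuousP => s /=; rewrite in_itv/= => sY.
  have s0 : 0 <= s by lra.
  apply: cvg_trans (has_derive_continuous (oleinik_u_ode t0 xX s0)).
  by apply: cvg_app; apply: within_subset => z;
    rewrite /Rge0 /= !in_itv/= andbT => /andP[].
- by rewrite oleinik_u_wall// ge_min le_max; lra.
by move=> y; rewrite in_itv/= => /andP[y0 _] uy; exists y.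
Qed.

Lemma oleinik_w_gt0 t x e : 0 <= t -> 0 <= x <= X -> 0 <= e < 1 -> 0 < w t x e.
Proof.
by move=> t0 xX e01; have [y y0 <-] := oleinik_u_onto t0 xX e01;
  exact: oleinik_w_u_gt0.
Qed.

Lemma oleinik_w_cont : continuous_box Rge0 `[0, X] `[0, 1] w.
Proof.
apply/continuous_boxP => t x e tE xE eE eps eps0.
have toP (t' x' : R) : Rge0 t' -> `[0, X]%classic x' -> 0 <= t' /\ 0 <= x' <= X.
  by rewrite /Rge0 /= !in_itv/= andbT.
have [t0 xX] := toP _ _ tE xE.
have e01 : 0 <= e <= 1 by move: eE; rewrite /= in_itv.
have outer (t' x' : R) : Rge0 t' -> `[0, X]%classic x' -> w t' x' 1 = 0.
  by move=> tE' xE'; have [] := toP _ _ tE' xE';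
    exact: (crocco_outer (oleinik_crocco OS)).
have [e1|e1] := eqVneq e 1.
  rewrite e1 outer//.
  have /cvg_boxP /(_ eps eps0)[d d0 Hd] := oleinik_w_eta1 OS t0 xX.
  exists d => // t' x' e' At Bx Ee td xd ed.
  have [e1'|e1'] := eqVneq e' 1; first by rewrite e1' outer// subrr normr0.
  apply: Hd => //; move: Ee; rewrite /= !in_itv/= => /andP[-> /=].
  by rewrite le_eqVlt (negbTE e1').
have {}e1 : e < 1 by rewrite lt_neqAle e1; lra.
have [/continuous_boxP C _] := oleinik_C2 OS.
have eE' : `[0, 1[%classic e by rewrite /= in_itv/=; lra.
have [d d0 Hd] := C t x e tE xE eE' eps eps0.
exists (Num.min d (1 - e)); first by rewrite lt_min d0 subr_gt0.
move=> t' x' e' At Bx Ee; rewrite !lt_min =>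
  /andP[td _] /andP[xd _] /andP[ed ee].
apply: Hd => //; move: Ee ee; rewrite /= !in_itv/= => /andP[-> _] /=.
by rewrite ltr_norml; lra.
Qed.

Lemma oleinik_positive_crocco : positive_crocco_solution X w.
Proof.
have [_ [D1 _ _ [_ [D3 _ _ _]]]] := oleinik_C2 OS.
have inE3 (t x e : R) : 0 <= t -> 0 <= x <= X -> 0 <= e < 1 ->
   [/\ Rge0 t, `[0, X]%classic x & `[0, 1[%classic e].
  by move=> *; rewrite /Rge0 /= !in_itv/= andbT.
split.
- move=> t x e t0 xX e1; have [a b c] := inE3 _ _ _ t0 xX e1.
  by have [D _ _] := D1 t x e a b c; exact: derivable_within_has_derive D.
- move=> t x e t0 xX e1; have [a b c] := inE3 _ _ _ t0 xX e1.
  by have [_ D _] := D1 t x e a b c; exact: derivable_within_has_derive D.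
- move=> t x e t0 xX e1; have [a b c] := inE3 _ _ _ t0 xX e1.
  by have [_ _ D] := D1 t x e a b c; exact: derivable_within_has_derive D.
- move=> t x e t0 xX e1; have [a b c] := inE3 _ _ _ t0 xX e1.
  by have [_ _ D] := D3 t x e a b c; exact: derivable_within_has_derive D.
- by move=> t x e t0 xX e1; have := crocco_eq (oleinik_crocco OS) t0 xX e1; lra.
- move=> t x t0 xX; have /eqP := crocco_wall (oleinik_crocco OS) t0 xX.
  by rewrite mulf_eq0 gt_eqF ?oleinik_w_gt0 ?lexx ?ltr01//= => /eqP.
- by move=> t x t0 xX; exact: (crocco_outer (oleinik_crocco OS)).
- exact: oleinik_w_gt0.
- exact: oleinik_w_cont.
Qed.

End Profile.

(** * Comparison for the Crocco problem *)

Section Barriers.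
Context {R : realType}.
Implicit Types (A : set R) (t x e s k : R) (X : R).

(** The eta-profile of the lower barrier: it vanishes like 1 - eta, is
    increasing at the wall, as the Neumann condition demands, and is convex for
    eta <= 1/9, where the factor eta in the transport term is of no help. *)
Definition lower_profile e : R := (1 + e + e ^+ 2 - 3 * e ^+ 3) / 10.

Lemma is_derive_lower_profile e :
  is_derive e 1 lower_profile ((1 + 2 * e - 9 * e ^+ 2) / 10).
Proof.
apply/is_derive1_caratheodory.
exists (fun s => (1 + (s + e) - 3 * (s * s + s * e + e * e)) / 10); split.
- by move=> s; rewrite /lower_profile; field.
- apply: cvgM; last exact: cvg_cst.
  apply: cvgB; first by apply: cvgD; [exact: cvg_cst|apply: cvgD;
    [exact: cvg_id|exact: cvg_cst]].
  apply: cvgM; first exact: cvg_cst.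
  apply: cvgD; last exact: cvg_cst.
  apply: cvgD; first by apply: cvgM; exact: cvg_id.
  by apply: cvgM; [exact: cvg_id|exact: cvg_cst].
- by field.
Qed.

Lemma is_derive2_lower_profile e :
  is_derive e 1 (fun s => (1 + 2 * s - 9 * s ^+ 2) / 10) ((2 - 18 * e) / 10).
Proof.
apply/is_derive1_caratheodory.
exists (fun s => (2 - 9 * (s + e)) / 10); split.
- by move=> s; field.
- apply: cvgM; last exact: cvg_cst.
  apply: cvgB; first exact: cvg_cst.
  by apply: cvgM; [exact: cvg_cst|apply: cvgD; [exact: cvg_id|exact: cvg_cst]].
- by field.
Qed.

Lemma lower_profileE e :
  lower_profile e = (1 - e) * ((1 + 2 * e + 3 * e ^+ 2) / 10).
Proof. by rewrite /lower_profile; field. Qed.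

Lemma lower_profile_bounds e : 0 <= e <= 1 ->
  (1 - e) / 10 <= lower_profile e <= 1 - e.
Proof.
move=> eI; rewrite lower_profileE; have e2 := sqr_ge0 e.
have e3 : e ^+ 2 <= 1 by rewrite expr_le1//; lra.
apply/andP; split; first by rewrite ler_wpM2l//; lra.
rewrite ler_piMr//; lra.
Qed.

(** With psi the barrier, at a positive maximum of psi - w the equation gives
    w^2 psi_{eta eta} <= - 20 eta psi < 0. This is absurd where psi is convex;
    elsewhere eta > 1/9 and w^2 |psi_{eta eta}| <= psi^2 |psi_{eta eta}|, which
    is at most 2 eta psi. *)
Lemma crocco_lower_bound X w c : positive_crocco_solution X w -> 0 < c <= 1 ->
  (forall t x e, 0 <= t -> 0 <= x <= X -> 0 <= e < 1 -> t = 0 \/ x = 0 ->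
     c * (1 - e) <= w t x e) ->
  forall t x e, 0 <= t -> 0 <= x <= X -> 0 <= e < 1 ->
  c * expR (- 20 * x) * lower_profile e <= w t x e.
Proof.
move=> W c01 wbd t0 x0 e0 t00 x0X e01.
pose P x := c * expR (- 20 * x).
have P0 x : 0 < P x by rewrite mulr_gt0 ?expR_gt0//; lra.
rewrite -subr_le0.
apply: (@parabolic_comparison R t0 X
  (fun t x e => P x * lower_profile e - w t x e)
  (fun t x e => 0 - pderiv1 Rge0 w t x e)
  (fun t x e => lower_profile e * (c * (- 20 * expR (- 20 * x))) -
     pderiv2 `[0, X] w t x e)
  (fun t x e => P x * ((1 + 2 * e - 9 * e ^+ 2) / 10) - pderiv3 `[0, 1[ w t x e)
  (fun t x e => P x * ((2 - 18 * e) / 10) -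
     pderiv3 `[0, 1[ (pderiv3 `[0, 1[ w) t x e)) => //; last 2 first.
- by rewrite t00 lexx.
- lra.
- apply: continuous_boxB.
    apply: (@continuous_boxT R _ _ _ (fun p =>
      P p.1.2 * lower_profile p.2)) => p.
    apply: cvgM.
      apply: cvgM; first exact: cvg_cst.
      apply: (continuous_comp (f := fun q : R * R * R => - 20 * q.1.2)).
        apply: cvgM; first exact: cvg_cst.
        by apply: cvg_comp; [exact: cvg_fst|exact: cvg_snd].
      exact: continuous_expR.
    apply: (continuous_comp (f := snd)); first exact: cvg_snd.
    apply: differentiable_continuous; apply/derivable1_diffP.
    exact: (@ex_derive _ _ _ _ _ _ _ (is_derive_lower_profile p.2)).
  apply: continuous_box_sub (pcs_cont W) => // z;
    rewrite /Rge0 /= !in_itv/= andbT.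
  by case/andP.
- move=> t x e tp xX eI; have t0' : 0 <= t by lra.
  have xX' : 0 <= x <= X by lra.
  split.
  + by apply: has_deriveB; [exact: has_derive_cst|exact: (pcs_dt W)].
  + apply: has_deriveB; last exact: (pcs_dx W).
    apply: is_derive_has_derive.
    rewrite [X in is_derive _ _ X](_ : _ =
      (fun s => lower_profile e * P s)); last first.
      by apply/funext => s; rewrite mulrC.
    exact/is_derive_scale/is_derive_scale/is_derive_expR_lin.
  + apply: has_deriveB; last exact: (pcs_de W).
    exact/is_derive_has_derive/is_derive_scale/is_derive_lower_profile.
  + apply: has_deriveB; last exact: (pcs_dee W).
    exact/is_derive_has_derive/is_derive_scale/is_derive2_lower_profile.
- move=> t x e tT xX eI; have t0' : 0 <= t by lra.
  have [->|e1] := eqVneq e 1.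
    by rewrite (pcs_outer W)// lower_profileE subrr mul0r mulr0 subrr.
  have eI' : 0 <= e < 1 by rewrite lt_neqAle e1; lra.
  move=> tx; have {}tx : t = 0 \/ x = 0.
    by case: tx => [|[|/eqP]]; [left|right|rewrite (negbTE e1)].
  rewrite subr_le0 (le_trans _ (wbd _ _ _ t0' xX eI' tx))//.
  have /andP[k0 k1] := lower_profile_bounds eI.
  have Pc : P x <= c.
    rewrite /P ler_piMr//; first lra.
    by rewrite -[leRHS]expR0 ler_expR; lra.
  by apply: ler_pM => //; [exact/ltW|lra].
- move=> t x tp xX; rewrite (pcs_wall W); [|lra|lra].
  rewrite subr0 mulr0 expr0n/= mulr0 addr0 subr0 mulr_gt0//; lra.
- move=> t x e tp xX eI hp ht hx hee.
  have := pcs_eq W tp xX eI.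
  have w0 : 0 < w t x e by apply: (pcs_gt0 W); lra.
  have /andP[k0 k1] : (1 - e) / 10 <= lower_profile e <= 1 - e.
    by apply: lower_profile_bounds; lra.
  have P1 : P x <= 1.
    rewrite /P mulr_ile1 ?expR_ge0//; [lra|lra|].
    by rewrite -[leRHS]expR0 ler_expR; lra.
  set psi := P x * lower_profile e.
  have psi0 : 0 < psi by rewrite mulr_gt0//; lra.
  have psi1 : psi <= 1 by rewrite mulr_ile1//; [exact/ltW|lra|lra].
  have wpsi : w t x e < psi by rewrite -subr_gt0.
  have wx : e * pderiv2 `[0, X] w t x e <= - (20 * (e * psi)).
    rewrite [leRHS](_ : _ = e * (- 20 * psi)); last by ring.
    rewrite ler_wpM2l//; first lra.
    by move: hx; rewrite /psi /P; lra.
  have wee : w t x e ^+ 2 * (P x * ((2 - 18 * e) / 10)) <=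
      w t x e ^+ 2 * pderiv3 `[0, 1[ (pderiv3 `[0, 1[ w) t x e.
    by rewrite ler_wpM2l ?sqr_ge0//; lra.
  have ep : 0 < e * psi by rewrite mulr_gt0//; lra.
  (* -2 > -20 leaves room for the equation to fail. *)
  suff : - (2 * (e * psi)) <= w t x e ^+ 2 * (P x * ((2 - 18 * e) / 10)) by lra.
  have [e9|e9] := leP 0 (2 - 18 * e).
    rewrite (@le_trans _ _ 0)//; first lra.
    apply: mulr_ge0; [exact: sqr_ge0|apply: mulr_ge0; [exact/ltW|lra]].
  have w2 : w t x e ^+ 2 <= psi.
    rewrite expr2 (@le_trans _ _ (psi * 1))//; last by rewrite mulr1.
    apply: ler_pM; [exact: ltW|exact: ltW|exact: ltW|].
    exact: le_trans (ltW wpsi) psi1.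
  have : w t x e ^+ 2 * P x * ((18 * e - 2) / 10) <= psi * 1 * (2 * e).
    apply: ler_pM; [|lra| |lra].
      by rewrite mulr_ge0 ?sqr_ge0 ?(ltW (P0 _)).
    by apply: ler_pM; [exact: sqr_ge0|exact/ltW| |].
  lra.
Qed.

(** [parabolic_comparison] for p - q - g, with the two equations substituted for
    the first order derivatives. *)
Lemma crocco_difference_le X p q (g gt ge gee : R -> R -> R) :
  positive_crocco_solution X p -> positive_crocco_solution X q ->
  continuous_box Rge0 `[0, X] `[0, 1] (fun t _ e => g t e) ->
  (forall t e, 0 < t -> 0 <= e < 1 ->
     [/\ has_derive Rge0 (g ^~ e) t (gt t e),
         has_derive `[0, 1[ (g t) e (ge t e) &
         has_derive `[0, 1[ (ge t) e (gee t e)]) ->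
  (forall t, 0 <= t -> 0 <= g t 1) ->
  (forall t, 0 < t -> ge t 0 < 0) ->
  (forall t x e, 0 < t -> 0 < x <= X -> 0 < e < 1 ->
     q t x e + g t e < p t x e ->
     let pee := pderiv3 `[0, 1[ (pderiv3 `[0, 1[ p) t x e in
     let qee := pderiv3 `[0, 1[ (pderiv3 `[0, 1[ q) t x e in
     pee - qee <= gee t e ->
     p t x e ^+ 2 * pee - q t x e ^+ 2 * qee < gt t e) ->
  (forall t x e, 0 <= t -> 0 <= x <= X -> 0 <= e < 1 -> t = 0 \/ x = 0 ->
     p t x e - q t x e <= g t e) ->
  forall t x e, 0 <= t -> 0 <= x <= X -> 0 <= e < 1 ->
    p t x e - q t x e <= g t e.
Proof.
move=> P Q gcont gder g0 gwall gsup bd t0 x0 e0 t00 x0X e01.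
rewrite -subr_le0.
apply: (@parabolic_comparison R t0 X (fun t x e => p t x e - q t x e - g t e)
  (fun t x e => pderiv1 Rge0 p t x e - pderiv1 Rge0 q t x e - gt t e)
  (fun t x e => pderiv2 `[0, X] p t x e - pderiv2 `[0, X] q t x e - 0)
  (fun t x e => pderiv3 `[0, 1[ p t x e - pderiv3 `[0, 1[ q t x e - ge t e)
  (fun t x e => pderiv3 `[0, 1[ (pderiv3 `[0, 1[ p) t x e -
     pderiv3 `[0, 1[ (pderiv3 `[0, 1[ q) t x e - gee t e)) => //; last 2 first.
- by rewrite t00 lexx.
- lra.
- apply: (@continuous_box_sub R Rge0 `[0, X] `[0, 1]) => //.
    by move=> z; rewrite /Rge0 /= !in_itv/= andbT; case/andP.
  by apply: continuous_boxB gcont; apply: continuous_boxB;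
    [exact: (pcs_cont P)|exact: (pcs_cont Q)].
- move=> t x e tp xX eI; have t0' : 0 <= t by lra.
  have xX' : 0 <= x <= X by lra.
  have [G1 G2 G3] := gder t e tp eI.
  split.
  + by apply: has_deriveB G1; apply: has_deriveB;
      [exact: (pcs_dt P)|exact: (pcs_dt Q)].
  + by apply: has_deriveB (has_derive_cst _ _ _); apply: has_deriveB;
      [exact: (pcs_dx P)|exact: (pcs_dx Q)].
  + by apply: has_deriveB G2; apply: has_deriveB;
      [exact: (pcs_de P)|exact: (pcs_de Q)].
  + by apply: has_deriveB G3; apply: has_deriveB;
      [exact: (pcs_dee P)|exact: (pcs_dee Q)].
- move=> t x e tT xX eI.
  have t0' : 0 <= t by lra.
  have [->|e1] := eqVneq e 1.
    by rewrite (pcs_outer P)// (pcs_outer Q)// !sub0r oppr0 sub0r oppr_le0 =>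
      _; exact: g0.
  have eI' : 0 <= e < 1 by rewrite lt_neqAle e1; lra.
  case=> [tz|[xz|/eqP]]; last by rewrite (negbTE e1).
  + by rewrite subr_le0; apply: bd => //; left.
  + by rewrite subr_le0; apply: bd => //; right.
- move=> t x tp xX; rewrite (pcs_wall P) ?(pcs_wall Q); [|lra..].
  by have := gwall t tp; lra.
- move=> t x e tp xX eI hp ht hx hee.
  have eqp := pcs_eq P tp xX eI; have eqq := pcs_eq Q tp xX eI.
  have qgp : q t x e + g t e < p t x e by rewrite -subr_gt0 opprD addrA.
  have := gsup t x e tp xX eI qgp; rewrite /= -subr_le0 => /(_ hee).
  rewrite -eqp -eqq => G.
  have : 0 <= e * (pderiv2 `[0, X] p t x e - pderiv2 `[0, X] q t x e - 0).
    by apply: mulr_ge0 => //; lra.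
  by move: G ht; lra.
Qed.

(** Both signs reduce to the identity
    p^2 p_ee - q^2 q_ee = w^2 (p - q)_ee + (p^2 - q^2) v_ee, valid for
    (p, q) = (w, v) and (v, w), in which the last term is nonpositive when
    p > q and v is concave. *)
Lemma crocco_difference_bound X w v (g gt ge gee : R -> R -> R) :
  positive_crocco_solution X w -> positive_crocco_solution X v ->
  (forall t x e, 0 <= t -> 0 <= x <= X -> 0 <= e < 1 ->
     pderiv3 `[0, 1[ (pderiv3 `[0, 1[ v) t x e <= 0) ->
  continuous_box Rge0 `[0, X] `[0, 1] (fun t _ e => g t e) ->
  (forall t e, 0 < t -> 0 <= e < 1 ->
     [/\ has_derive Rge0 (g ^~ e) t (gt t e),
         has_derive `[0, 1[ (g t) e (ge t e) &
         has_derive `[0, 1[ (ge t) e (gee t e)]) ->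
  (forall t e, 0 <= t -> 0 <= e <= 1 -> 0 <= g t e) ->
  (forall t, 0 < t -> ge t 0 < 0) ->
  (forall t x e, 0 < t -> 0 < x <= X -> 0 < e < 1 ->
     w t x e ^+ 2 * gee t e < gt t e) ->
  (forall t x e, 0 <= t -> 0 <= x <= X -> 0 <= e < 1 -> t = 0 \/ x = 0 ->
     `|w t x e - v t x e| <= g t e) ->
  forall t x e, 0 <= t -> 0 <= x <= X -> 0 <= e < 1 ->
    `|w t x e - v t x e| <= g t e.
Proof.
move=> W V vcc gcont gder g0 gwall gsup bd.
have key (p q m d : R) : 0 < q -> 0 <= m -> q + m < p -> d <= 0 ->
    (p ^+ 2 - q ^+ 2) * d <= 0.
  by move=> q0 m0 qp d0; rewrite mulr_ge0_le0// subr_ge0 ler_sqr ?nnegrE; lra.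
move=> t x e t0 xX eI; rewrite ler_norml lerNl opprB.
apply/andP; split.
  apply: (crocco_difference_le V W gcont gder) => //.
  - by move=> s s0; apply: g0 => //; lra.
  - move=> {t x e t0 xX eI} t x e tp xX eI; cbv zeta.
    set vee := pderiv3 _ _ _ _ _; set wee := pderiv3 _ _ _ _ _ => wv hee.
    have t0 : 0 <= t by lra.
    have xX' : 0 <= x <= X by lra.
    have eI' : 0 <= e < 1 by lra.
    have eI2 : 0 <= e <= 1 by lra.
    have w0 := pcs_gt0 W t0 xX' eI'.
    have K := key _ _ _ _ w0 (g0 t e t0 eI2) wv (vcc _ _ _ t0 xX' eI').
    have : w t x e ^+ 2 * (vee - wee) <= w t x e ^+ 2 * gee t e.
      by rewrite ler_wpM2l// sqr_ge0.
    by have := gsup _ _ _ tp xX eI; move: K; rewrite -/vee; lra.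
  - move=> {t x e t0 xX eI} t x e t0 xX eI /(bd _ _ _ t0 xX eI).
    by rewrite distrC; exact/le_trans/ler_norm.
apply: (crocco_difference_le W V gcont gder) => //.
- by move=> s s0; apply: g0 => //; lra.
- move=> {t x e t0 xX eI} t x e tp xX eI; cbv zeta.
  set wee := pderiv3 _ _ _ _ _; set vee := pderiv3 _ _ _ _ _ => wv hee.
  have t0 : 0 <= t by lra.
  have xX' : 0 <= x <= X by lra.
  have eI' : 0 <= e < 1 by lra.
  have eI2 : 0 <= e <= 1 by lra.
  have w0 := pcs_gt0 W t0 xX' eI'.
  have v0 := pcs_gt0 V t0 xX' eI'.
  have K := key _ _ _ _ v0 (g0 t e t0 eI2) wv (vcc _ _ _ t0 xX' eI').
  have : w t x e ^+ 2 * (wee - vee) <= w t x e ^+ 2 * gee t e.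
    by rewrite ler_wpM2l// sqr_ge0.
  by have := gsup _ _ _ tp xX eI; move: K; rewrite -/vee; lra.
- move=> {t x e t0 xX eI} t x e t0 xX eI /(bd _ _ _ t0 xX eI).
  exact/le_trans/ler_norm.
Qed.

End Barriers.

(** * From the Crocco variables back to velocity profiles *)

Section ConcaveProfile.
Context {R : realType} (X : R) (v : R -> R -> R -> R).
Implicit Types (t x e s a c : R).
Context (V : positive_crocco_solution X v).
Context (vcc : forall t x e, 0 <= t -> 0 <= x <= X -> 0 <= e < 1 ->
  pderiv3 `[0, 1[ (pderiv3 `[0, 1[ v) t x e <= 0).

Let sub01 (a c z : R) : 0 <= a -> c < 1 -> a <= z <= c -> `[0, 1[%classic z.
Proof. by move=> a0 c1 zac; rewrite /= in_itv/=; lra. Qed.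

Lemma concave_slope_homo t x a c : 0 <= t -> 0 <= x <= X -> 0 <= a <= c ->
  c < 1 ->
  pderiv3 `[0, 1[ v t x c <= pderiv3 `[0, 1[ v t x a.
Proof.
move=> t0 xX ac c1; rewrite -subr_le0.
apply: (@growth_nonpos _ `[0, 1[
  (fun s => pderiv3 `[0, 1[ v t x s - pderiv3 `[0, 1[ v t x a)
  (fun s => pderiv3 `[0, 1[ (pderiv3 `[0, 1[ v) t x s - 0) a c).
- lra.
- by move=> s; apply: sub01; lra.
- by move=> s sac; apply: (has_deriveB _ (@has_derive_cst _ _ _ _));
    apply: (pcs_dee V) => //; lra.
- by rewrite subrr.
- by move=> s sac _; rewrite subr0; apply: vcc => //; lra.
Qed.

(** The slope is nonincreasing in eta and vanishes at the wall. *)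
Lemma concave_crocco_decreasing t x a c : 0 <= t -> 0 <= x <= X ->
  0 <= a <= c -> c < 1 -> v t x c <= v t x a.
Proof.
move=> t0 xX ac c1; rewrite -subr_le0.
apply: (@growth_nonpos _ `[0, 1[ (fun s => v t x s - v t x a)
  (fun s => pderiv3 `[0, 1[ v t x s - 0) a c).
- lra.
- by move=> s; apply: sub01; lra.
- by move=> s sac; apply: (has_deriveB _ (@has_derive_cst _ _ _ _));
    apply: (pcs_de V) => //; lra.
- by rewrite subrr.
- move=> s sac _; rewrite subr0 -[leRHS](pcs_wall V t0 xX).
  by apply: concave_slope_homo => //; lra.
Qed.

(** The tangent at a lies above v > 0; evaluate it at the midpoint of a and
    1. *)
Lemma concave_slope_bound t x a : 0 <= t -> 0 <= x <= X -> 0 <= a < 1 ->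
  - pderiv3 `[0, 1[ v t x a * ((1 - a) / 2) <= v t x a.
Proof.
move=> t0 xX a01; pose c := (1 + a) / 2.
have c1 : a <= c < 1 by rewrite /c; lra.
set m := pderiv3 _ _ _ _ _.
suff : v t x c - m * c - (v t x a - m * a) <= 0.
  have : 0 < v t x c by apply: (pcs_gt0 V) => //; lra.
  have -> : m * c = m * ((1 + a) / 2) by [].
  lra.
apply: (@growth_nonpos _ `[0, 1[
  (fun s => v t x s - m * s - (v t x a - m * a))
  (fun s => pderiv3 `[0, 1[ v t x s - m - 0) a c).
- lra.
- by move=> s; apply: sub01; lra.
- move=> s sac; apply: (has_deriveB _ (@has_derive_cst _ _ _ _)).
  by apply: (has_deriveB _ (@has_derive_lin _ _ _ _));
    apply: (pcs_de V) => //; lra.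
- by rewrite subrr.
- move=> s sac _; rewrite subr0 subr_le0 /m.
  by apply: concave_slope_homo => //; lra.
Qed.

(** On [0, 1 - k], [concave_slope_bound] bounds the slope by 2 v(0) / k, as v is
    largest at the wall. *)
Lemma concave_lipschitz t x k a c : 0 <= t -> 0 <= x <= X -> 0 < k ->
  0 <= a <= c -> c <= 1 - k -> v t x a - v t x c <= 2 * v t x 0 / k * (c - a).
Proof.
move=> t0 xX k0 ac ck; pose L := 2 * v t x 0 / k.
rewrite -subr_le0.
suff : v t x a - v t x c - (L * c - L * a) <= 0 by rewrite -mulrBr.
have -> : v t x a - v t x c - (L * c - L * a) =
    v t x a + L * a - v t x c - L * c.
  by ring.
apply: (@growth_nonpos _ `[0, 1[ (fun s => v t x a + L * a - v t x s - L * s)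
  (fun s => 0 - pderiv3 `[0, 1[ v t x s - L) a c).
- lra.
- by move=> s; apply: sub01; lra.
- move=> s sac; apply: (has_deriveB _ (@has_derive_lin _ _ _ _)).
  by apply: (has_deriveB (@has_derive_cst _ _ _ _)); apply: (pcs_de V) => //;
    lra.
- lra.
- move=> s sac _.
  have s01 : 0 <= s < 1 by lra.
  have B := concave_slope_bound t0 xX s01.
  have D : v t x s <= v t x 0 by apply: concave_crocco_decreasing => //; lra.
  set m := pderiv3 _ _ _ _ _ in B *.
  have [m0|m0] := leP 0 m.
    have : 0 <= L by rewrite divr_ge0 ?mulr_ge0//;
      [apply/ltW/(pcs_gt0 V) => //; lra|lra].
    lra.
  have : - m <= L.
    rewrite /L ler_pdivlMr//.
    have : - m * k <= - m * (1 - s) by rewrite ler_wpM2l//; lra.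
    lra.
  lra.
Qed.

End ConcaveProfile.

Section ProfileComparison.
Context {R : realType} (X : R).
Context (u0 u1 : R -> R -> R) (u : R -> R -> R -> R) (w0 w1 : R -> R -> R)
  (w : R -> R -> R -> R).
Implicit Types (t x y s e : R).
Context (OS : oleinik_solution X u0 u1 u w0 w1 w).

Let Rge0_itv (y z : R) : 0 <= z <= y -> Rge0 z.
Proof. by move=> zy; rewrite /Rge0 /= in_itv/= andbT; lra. Qed.

(** f = 1 - u satisfies f_y = - w(u) <= - b f and f = 1 at the wall. *)
Lemma outer_flow_tail (b : R) t x y : 0 <= t -> 0 <= x <= X -> 0 <= y ->
  0 < b ->
  (forall e, 0 <= e < 1 -> b * (1 - e) <= w t x e) ->
  1 - u t x y <= expR (- b * y).
Proof.
move=> t0 xX y0 b0 wb; rewrite -subr_le0.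
apply: (@growth_nonpos _ Rge0 (fun s => 1 - u t x s - expR (- b * s))
  (fun s => 0 - w t x (u t x s) - (- b * expR (- b * s))) 0 y) => //.
- exact: Rge0_itv.
- move=> s s0y; apply: has_deriveB.
    by apply: (has_deriveB (@has_derive_cst _ _ _ _));
      apply: (oleinik_u_ode OS) => //; lra.
  exact/is_derive_has_derive/is_derive_expR_lin.
- by rewrite (oleinik_u_wall OS)// mulr0 expR0; lra.
- move=> s s0y psi0.
  have B := wb (u t x s).
  have s0 : 0 <= s by lra.
  rewrite (oleinik_u_ge0 OS)// (oleinik_u_lt1 OS)// in B.
  have {}B := B isT.
  have : 0 < b * (1 - u t x s - expR (- b * s)) by rewrite mulr_gt0.
  lra.
Qed.

Context (p0 p1 : R -> R -> R) (p : R -> R -> R -> R) (q0 q1 : R -> R -> R)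
  (q : R -> R -> R -> R).
Context (OSp : oleinik_solution X p0 p1 p q0 q1 q).

(** The vector fields are compared only where u >= p, which is what allows the
    monotonicity of one of them to be used. *)
Lemma ode_difference_le (S : R) t x y : 0 <= t -> 0 <= x <= X -> 0 <= y ->
  0 <= S ->
  (forall s, 0 <= s -> p t x s <= u t x s ->
    w t x (u t x s) - q t x (p t x s) <= S) ->
  u t x y - p t x y <= S * y.
Proof.
move=> t0 xX y0 S0 H; rewrite -subr_le0.
apply: (@growth_nonpos _ Rge0 (fun s => u t x s - p t x s - S * s)
  (fun s => w t x (u t x s) - q t x (p t x s) - S) 0 y) => //.
- exact: Rge0_itv.
- move=> s s0y; apply: (has_deriveB _ (@has_derive_lin _ _ _ _)).
  by apply: has_deriveB; [apply: (oleinik_u_ode OS)|apply: (oleinik_u_ode OSp)]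
    => //; lra.
- by rewrite (oleinik_u_wall OS)// (oleinik_u_wall OSp)//; lra.
- move=> s s0y psi0.
  have : 0 <= S * s by rewrite mulr_ge0//; lra.
  move=> Ss; have := H s ltac:(lra) ltac:(lra).
  lra.
Qed.

End ProfileComparison.

Section SteadyComparison.
Context {R : realType} (X : R).
Context (u0 u1 : R -> R -> R) (u : R -> R -> R -> R) (w0 w1 : R -> R -> R)
  (w : R -> R -> R -> R).
Context (p0 p1 : R -> R -> R) (p : R -> R -> R -> R) (q0 q1 : R -> R -> R)
  (q : R -> R -> R -> R).
Implicit Types (t x y s e : R).
Context (OS : oleinik_solution X u0 u1 u w0 w1 w).
Context (OSp : oleinik_solution X p0 p1 p q0 q1 q).
Context (qcc : forall t x e, 0 <= t -> 0 <= x <= X -> 0 <= e < 1 ->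
  pderiv3 `[0, 1[ (pderiv3 `[0, 1[ q) t x e <= 0).

Let Q := oleinik_positive_crocco OSp.

(** Where u > p, w(u) - q(p) splits as (w - q)(u), at most S, plus q(u) - q(p),
    which is nonpositive because q is nonincreasing. *)
Lemma profile_difference (S : R) t x y : 0 <= t -> 0 <= x <= X -> 0 <= y ->
  (forall e, 0 <= e < 1 -> `|w t x e - q t x e| <= S) ->
  `|u t x y - p t x y| <= S * y.
Proof.
move=> t0 xX y0 H.
have S0 : 0 <= S by apply: le_trans (H 0 _); rewrite ?normr_ge0 ?lexx ?ltr01.
have I s : 0 <= s -> [/\ 0 <= u t x s, u t x s < 1, 0 <= p t x s & p t x s < 1].
  by move=> s0; split; [apply: (oleinik_u_ge0 OS)|apply: (oleinik_u_lt1 OS)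
    |apply: (oleinik_u_ge0 OSp)|apply: (oleinik_u_lt1 OSp)].
rewrite ler_norml lerNl opprB; apply/andP; split.
  apply: (ode_difference_le OSp OS) => // s s0 us.
  have [u_0 u_1 p_0 p_1] := I s s0.
  have : q t x (p t x s) <= q t x (u t x s).
    by apply: (concave_crocco_decreasing Q) => //; rewrite u_0.
  have := H (u t x s); rewrite u_0 u_1 ler_norml => /(_ isT)/andP[]; lra.
apply: (ode_difference_le OS OSp) => // s s0 us.
have [u_0 u_1 p_0 p_1] := I s s0.
have : q t x (u t x s) <= q t x (p t x s).
  by apply: (concave_crocco_decreasing Q) => //; rewrite p_0.
have := H (u t x s); rewrite u_0 u_1 ler_norml => /(_ isT)/andP[]; lra.
Qed.

(** For e <= 1 - k, write e = u(y). Then k <= 1 - u(y) <= e^(-b y) bounds y by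
    - ln k / b, so |u - p|(y) <= d (- ln k / b), and
    w(e) - q(e) = (w(u(y)) - q(p(y))) + (q(p(y)) - q(u(y))) is controlled by d
    and by the Lipschitz constant of q on [0, 1 - k / 2]. *)
Lemma crocco_close_of_shear_close (b k d M sigma : R) t x : 0 <= t ->
  0 <= x <= X ->
  0 < b -> 0 < k < 1 -> 0 <= d ->
  (forall e, 0 <= e < 1 -> b * (1 - e) <= w t x e) ->
  (forall e, 1 - k < e < 1 -> w t x e <= sigma /\ q t x e <= sigma) ->
  q t x 0 <= M ->
  (forall y, 0 <= y -> `|w t x (u t x y) - q t x (p t x y)| <= d) ->
  d * (- ln k / b) <= k / 2 -> d + 4 * M / k * (d * (- ln k / b)) <= sigma ->
  forall e, 0 <= e < 1 -> `|w t x e - q t x e| <= sigma.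
Proof.
move=> t0 xX b0 k01 d0 wb tail qM H dk dsig e eI.
have [ek|ek] := ltP (1 - k) e.
  have [ws qs] := tail e ltac:(lra).
  have w_0 : 0 < w t x e by apply: (oleinik_w_gt0 OS).
  have q_0 : 0 < q t x e by apply: (oleinik_w_gt0 OSp).
  by rewrite ler_norml; lra.
have [y y0 uy] := oleinik_u_onto OS t0 xX eI.
have yY : y <= - ln k / b.
  rewrite ler_pdivlMr//.
  have := outer_flow_tail OS t0 xX y0 b0 wb; rewrite uy => tl.
  have : ln k <= ln (expR (- b * y)) by rewrite ler_ln ?posrE ?expR_gt0//; lra.
  by rewrite expRK; lra.
have up : `|u t x y - p t x y| <= d * (- ln k / b).
  apply: (@le_trans _ _ (d * y)); last by rewrite ler_wpM2l.
  rewrite ler_norml lerNl opprB; apply/andP; split.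
    apply: (ode_difference_le OSp OS) => // s s0 _.
    by have := H s s0; rewrite ler_norml; lra.
  apply: (ode_difference_le OS OSp) => // s s0 _.
  by have := H s s0; rewrite ler_norml; lra.
set D := d * _ in up dk dsig.
have p_0 := oleinik_u_ge0 OSp t0 xX y0.
have p_1 := oleinik_u_lt1 OSp t0 xX y0.
have q0_0 : 0 < q t x 0 by apply: (oleinik_w_gt0 OSp) => //; rewrite lexx ltr01.
(* d (- ln k / b) <= k / 2 keeps p(y) in [0, 1 - k / 2] as well. *)
have k2 : 0 < k / 2 by lra.
have lip z z' : 0 <= z <= z' -> z' <= 1 - k / 2 -> z' - z <= D ->
    0 <= q t x z - q t x z' <= 4 * M / k * D.
  move=> zz z'1 zD; apply/andP; split.
    by rewrite subr_ge0; apply: (concave_crocco_decreasing Q) => //; lra.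
  apply: (le_trans (concave_lipschitz Q qcc t0 xX k2 zz z'1)).
  apply: ler_pM => //; [|lra|].
    by rewrite divr_ge0//; lra.
  rewrite (_ : 4 * M / k = 2 * M / (k / 2)); last by field; lra.
  by rewrite ler_wpM2r ?invr_ge0//; lra.
have Hy := H y y0; rewrite uy in Hy up.
have : `|q t x e - q t x (p t x y)| <= 4 * M / k * D.
  have [ep|ep] := leP e (p t x y).
    have := lip e (p t x y); move: up; rewrite !ler_norml; lra.
  have := lip (p t x y) e; move: up; rewrite !ler_norml; lra.
move: Hy; rewrite !ler_norml; lra.
Qed.

End SteadyComparison.

(** * Essential suprema and pointwise bounds *)

Section Linfty.
Context {R : realType}.
Implicit Types (A B E : set R).

Lemma Linfty2_le A B (g : R -> R -> R) (r : R) : 0 <= r ->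
  (forall a b, A a -> B b -> `|g a b| <= r) -> (Linfty2 A B g <= r%:E)%E.
Proof.
move=> r0 gr; rewrite /Linfty2 unlock; case: ifP => _; last by rewrite lee_fin.
apply/ess_supP; apply: nearW => -[a b] /=; rewrite patchE; case: ifPn => [|_].
  by rewrite inE => -[/= Aa Bb]; rewrite lee_fin; exact: gr.
by rewrite abse0 lee_fin.
Qed.

Lemma Linfty3_le A B E (f : R -> R -> R -> R) (r : R) : 0 <= r ->
  (forall a b c, A a -> B b -> E c -> `|f a b c| <= r) ->
  (Linfty3 A B E f <= r%:E)%E.
Proof.
move=> r0 fr; rewrite /Linfty3 unlock; case: ifP => _; last by rewrite lee_fin.
apply/ess_supP; apply: nearW => -[[a b] c] /=; rewrite patchE;
  case: ifPn => [|_].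
  by rewrite inE => -[[/= Aa Bb] Ec]; rewrite lee_fin; exact: fr.
by rewrite abse0 lee_fin.
Qed.

(** A condition under which an almost everywhere bound on a continuous function
    on A holds everywhere: relatively open subsets have positive measure. *)
Definition thick A := forall a d : R, A a -> 0 < d ->
  exists p q : R, p < q /\ forall z, p < z < q -> A z /\ `|z - a| < d.

Lemma thick_Rge0 : thick Rge0.
Proof.
move=> a d; rewrite /Rge0 /= in_itv/= andbT => a0 d0; exists a, (a + d).
split; first lra.
by move=> z az; rewrite /= in_itv/= andbT ger0_norm; [split|]; lra.
Qed.

Lemma thick_itv (X : R) : 0 < X -> thick `[0, X].
Proof.
move=> X0 a d; rewrite /= in_itv/= => aX d0;
  exists (Num.max 0 (a - d)), (Num.min X (a + d)).
split; first by rewrite gt_max !lt_min; lra.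
move=> z; rewrite gt_max lt_min /= in_itv/= ltr_norml => zI; split; lra.
Qed.

Local Open Scope ereal_scope.

Lemma rectangle_gt0 (p q p' q' : R) : (p < q)%R -> (p' < q')%R ->
  0 < ((@lebesgue_measure R) \x (@lebesgue_measure R)) (`]p, q[ `*` `]p', q'[).
Proof.
move=> pq pq'; rewrite product_measure1E; [|exact: measurable_itv..].
by rewrite /= !lebesgue_measure_itv/= !lte_fin pq pq' -!EFinD -EFinM lte_fin
  mulr_gt0 ?subr_gt0.
Qed.

Lemma Linfty_null_set d (T : measurableType d) (mu : {measure set T -> \bar R})
    (f : T -> \bar R) (y : \bar R) : 0 < mu setT -> 'N[mu]_+oo[f] <= y ->
  exists N, [/\ measurable N, mu N = 0 & forall x, ~ N x -> `|f x| <= y].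
Proof.
rewrite unlock => -> /ess_supP[N [mN N0 HN]]; exists N; split => // x Nx.
by apply: contrapT => fx; apply: Nx; exact: HN.
Qed.

(** A null set contains no rectangle, and continuity would spread a violation
    of the bound over a rectangle. *)
Lemma Linfty2_pointwise A B (g : R -> R -> R) (r : R) : thick A -> thick B ->
  (forall a b : R, A a -> B b -> forall eps : R, (0 < eps)%R ->
     exists2 d : R, (0 < d)%R & forall a' b' : R, A a' -> B b' ->
      (`|a' - a| < d -> `|b' - b| < d -> `|g a' b' - g a b| < eps)%R) ->
  Linfty2 A B g <= r%:E ->
  forall a b, A a -> B b -> (`|g a b| <= r)%R.
Proof.
move=> tA tB gc gr a b Aa Bb; rewrite leNgt; apply/negP => rg.
have [d d0 Hd] := gc a b Aa Bb (`|g a b| - r)%R ltac:(lra).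
have [p [q [pq Hpq]]] := tA a d Aa d0.
have [p' [q' [pq' Hpq']]] := tB b d Bb d0.
have rect := rectangle_gt0 pq pq'.
have [|N [mN N0 HN]] := Linfty_null_set _ gr.
  apply: lt_le_trans rect _; apply: le_measure; rewrite ?inE//.
  by apply: measurableX; exact: measurable_itv.
suff : ((@lebesgue_measure R) \x (@lebesgue_measure R))
    (`]p, q[ `*` `]p', q'[) <= 0.
  by rewrite leNgt rect.
rewrite -N0; apply: le_measure; rewrite ?inE//.
  by apply: measurableX; exact: measurable_itv.
move=> [x y] [/=]; rewrite !in_itv/= => xI yI; apply: contrapT => /HN.
have [Ax xd] := Hpq x xI; have [By yd] := Hpq' y yI.
rewrite patchE ifT; last by rewrite inE.
rewrite /= lee_fin => xy; have D := Hd x y Ax By xd yd.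
have : (`|g a b| <= `|g x y| + `|g x y - g a b|)%R.
  by rewrite -[X in (`|X| <= _)%R](subKr (g x y)) ler_normB.
lra.
Qed.

Lemma ereal_cvg0 (F : R -> \bar R) : (forall t, 0 <= F t) ->
  (forall eps : R, (0 < eps)%R -> exists T : R, forall t, (T <= t)%R ->
    F t <= eps%:E) ->
  F @ +oo%R --> 0.
Proof.
move=> F0 H; apply/fine_cvgP; split.
  have [T HT] := H 1%R ltr01; exists T; split; first exact: num_real.
  by move=> t /ltW /HT Ft; rewrite ge0_fin_numE// (le_lt_trans Ft)// ltry.
apply/cvgrPdist_le => eps eps0; have [T HT] := H eps eps0.
exists T; split; first exact: num_real.
move=> t /ltW /HT Ft; rewrite sub0r normrN ger0_norm ?fine_ge0//=.
by rewrite -lee_fin fineK// ge0_fin_numE// (le_lt_trans Ft)// ltry.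
Qed.

End Linfty.

(** * Barriers for the difference of two Crocco transforms *)

Section BarrierBounds.
Context {R : realType}.
Implicit Types (t x e s k a : R) (X : R).

(** The constant S is not a strict supersolution and is flat at the wall;
    S + k (1 + t - eta) is strict in both respects, and k tends to 0. *)
Lemma crocco_difference_sup X w v (S : R) : positive_crocco_solution X w ->
  positive_crocco_solution X v ->
  (forall t x e, 0 <= t -> 0 <= x <= X -> 0 <= e < 1 ->
     pderiv3 `[0, 1[ (pderiv3 `[0, 1[ v) t x e <= 0) ->
  (forall t x e, 0 <= t -> 0 <= x <= X -> 0 <= e < 1 -> t = 0 \/ x = 0 ->
     `|w t x e - v t x e| <= S) ->
  forall t x e, 0 <= t -> 0 <= x <= X -> 0 <= e < 1 ->
    `|w t x e - v t x e| <= S.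
Proof.
move=> W V vcc bd t x e t0 xX eI.
have [X0 S0] : 0 <= X /\ 0 <= S.
  have xx : 0 <= X by lra.
  by split=> //; apply: le_trans (bd 0 0 0 _ _ _ _); rewrite ?lexx ?ltr01//;
    left.
apply/ler_addgt0Pr => eps eps0.
pose k := eps / (1 + t - e).
have k0 : 0 < k by rewrite divr_gt0//; lra.
suff : `|w t x e - v t x e| <= S + (k * (1 + t) - k * e).
  by rewrite -mulrBr /k divfK//; apply/eqP; lra.
apply: (@crocco_difference_bound R X w v (fun t e => S + (k * (1 + t) - k * e))
  (fun _ _ => k) (fun _ _ => - k) (fun _ _ => 0)) => //.
- apply: (@continuous_boxT R _ _ _ (fun p =>
    S + (k * (1 + p.1.1) - k * p.2))) => p.
  apply: cvgD; first exact: cvg_cst.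
  apply: cvgB.
    apply: cvgM; first exact: cvg_cst.
    apply: cvgD; first exact: cvg_cst.
    by apply: cvg_comp; [exact: cvg_fst|exact: cvg_fst].
  by apply: cvgM; [exact: cvg_cst|exact: cvg_snd].
- move=> t' e' t'0 e'I; split; apply: is_derive_has_derive.
  + apply/is_derive1_caratheodory; exists (fun=> k).
    by split => //; [move=> z; ring|exact: cvg_cst].
  + apply/is_derive1_caratheodory; exists (fun=> - k).
    by split => //; [move=> z; ring|exact: cvg_cst].
- move=> t' e' t'0 e'I; rewrite -mulrBr addr_ge0// mulr_ge0//; [exact: ltW|lra].
- by move=> t' _; lra.
- by move=> *; rewrite mulr0.
- move=> t' x' e' t'0 x'X e'I tx; apply: le_trans (bd _ _ _ t'0 x'X e'I tx) _.
  by rewrite -mulrBr lerDl mulr_ge0//; [exact: ltW|lra].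
Qed.

(** The norm makes the function continuous on the whole line: [powR] takes the
    value 1 on negative numbers. *)
Lemma continuous_powR_norm a : 0 < a -> continuous (fun s : R => `|s| `^ a).
Proof.
move=> a0 s; have [->|s0] := eqVneq s 0.
  apply/cvgrPdist_lt => e e0; rewrite normr0 powR0 ?gt_eqF//.
  have d0 : 0 < e `^ a^-1 by rewrite powR_gt0.
  exists (e `^ a^-1) => //= z; rewrite sub0r normrN => ze.
  have eE : (e `^ a^-1) `^ a = e.
    by rewrite -powRrM mulVf ?gt_eqF// powRr1// ltW.
  rewrite ger0_norm ?powR_ge0// -[ltRHS]eE.
  apply: gt0_ltr_powR => //; rewrite ?nnegrE ?powR_ge0//.
  by move: ze; rewrite /ball_/= sub0r normrN.
apply: (@continuous_comp _ _ _ (fun s : R => `|s|) (fun s => s `^ a)).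
  exact: norm_continuous.
apply: differentiable_continuous; apply/derivable1_diffP.
by apply: derivable_powR; rewrite in_itv/= andbT normr_gt0.
Qed.

Lemma is_derive_powR_outer a e : e < 1 ->
  is_derive e 1 (fun s => (1 - s) `^ a) (- a * (1 - e) `^ (a - 1)).
Proof.
move=> e1; rewrite mulNr -mulrN1.
apply: (@is_derive1_comp R (fun s => s `^ a) (fun s => 1 - s)).
  by apply: is_derive1_powR; lra.
by have := @is_deriveB _ R R (cst 1) id e 1 0 1 _ _; rewrite sub0r; apply.
Qed.

(** For g = C e^(-beta0 t) (1 - eta)^a, both g_t = - beta0 g and
    w^2 g_{eta eta} = - w^2 a (1 - a) (1 - eta)^(-2) g are negative, and the
    second is the smaller one since w^2 >= b^2 (1 - eta)^2. *)
Lemma crocco_difference_decay X w v (a b beta0 C : R) :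
  positive_crocco_solution X w -> positive_crocco_solution X v ->
  0 < a < 1 -> 0 < b -> beta0 < b ^+ 2 * a * (1 - a) -> 0 < C ->
  (forall t x e, 0 <= t -> 0 <= x <= X -> 0 <= e < 1 ->
    b * (1 - e) <= w t x e) ->
  (forall t x e, 0 <= t -> 0 <= x <= X -> 0 <= e < 1 ->
     pderiv3 `[0, 1[ (pderiv3 `[0, 1[ v) t x e <= 0) ->
  (forall t x e, 0 <= t -> 0 <= x <= X -> 0 <= e < 1 -> t = 0 \/ x = 0 ->
     `|w t x e - v t x e| <= C * expR (- beta0 * t) * (1 - e) `^ a) ->
  forall t x e, 0 <= t -> 0 <= x <= X -> 0 <= e < 1 ->
    `|w t x e - v t x e| <= C * expR (- beta0 * t) * (1 - e) `^ a.
Proof.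
move=> W V a01 b0 hbeta C0 wb vcc.
pose E t := C * expR (- beta0 * t).
have E0 t : 0 < E t by rewrite mulr_gt0 ?expR_gt0.
apply: (@crocco_difference_bound R X w v (fun t e => E t * (1 - e) `^ a)
  (fun t e => (1 - e) `^ a * (C * (- beta0 * expR (- beta0 * t))))
  (fun t e => E t * (- a * (1 - e) `^ (a - 1)))
  (fun t e => E t * (- a * (- (a - 1) * (1 - e) `^ (a - 1 - 1))))) => //.
- have /continuous_boxP H : continuous_box Rge0 `[0, X] `[0, 1]
      (fun t _ e => E t * `|1 - e| `^ a).
    apply: (@continuous_boxT R _ _ _ (fun p => E p.1.1 * `|1 - p.2| `^ a)) => p.
    apply: cvgM.
      apply: cvgM; first exact: cvg_cst.
      apply: (continuous_comp (f := fun q : R * R * R => - beta0 * q.1.1)).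
        apply: cvgM; first exact: cvg_cst.
        by apply: cvg_comp; [exact: cvg_fst|exact: cvg_fst].
      exact: continuous_expR.
    apply: (@continuous_comp _ _ _
      (fun q : R * R * R => 1 - q.2) (fun s => `|s| `^ a)).
      by apply: cvgB; [exact: cvg_cst|exact: cvg_snd].
    by apply: continuous_powR_norm; lra.
  apply/continuous_boxP => t x e tE xE eE eps eps0.
  have [d d0 Hd] := H t x e tE xE eE eps eps0;
    exists d => // t' x' e' t'E x'E e'E.
  have := Hd t' x' e' t'E x'E e'E; move: eE e'E; rewrite /= !in_itv/= => eI e'I.
  have -> : `|1 - e| = 1 - e by rewrite ger0_norm//; lra.
  by have -> : `|1 - e'| = 1 - e' by rewrite ger0_norm//; lra.
- move=> t e t0 eI; have e1 : e < 1 by lra.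
  split; apply: is_derive_has_derive.
  + rewrite [X in is_derive _ _ X](_ : _ = (fun s => (1 - e) `^ a * E s));
      last first.
      by apply/funext => s; rewrite mulrC.
    exact/is_derive_scale/is_derive_scale/is_derive_expR_lin.
  + exact/is_derive_scale/is_derive_powR_outer.
  + exact/is_derive_scale/is_derive_scale/is_derive_powR_outer.
- by move=> t e _ _; rewrite mulr_ge0 ?powR_ge0// ltW.
- move=> t _; rewrite subr0 powR1 mulr1 mulrN oppr_lt0 mulr_gt0//; lra.
- move=> t x e t0 xX eI.
  have r0 : 0 < 1 - e by lra.
  set r := 1 - e in r0 *.
  have -> : r `^ a = r ^+ 2 * r `^ (a - 1 - 1).
    rewrite -powR_mulrn ?ltW// -powRD; first by congr (_ `^ _); ring.
    by rewrite (gt_eqF r0) implybT.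
  have wr : b ^+ 2 * r ^+ 2 <= w t x e ^+ 2.
    rewrite -exprMn ler_sqr ?nnegrE; first by apply: wb; lra.
      by rewrite mulr_ge0// ltW.
    by apply/ltW/(pcs_gt0 W); lra.
  have D0 : 0 < E t * r `^ (a - 1 - 1) by rewrite mulr_gt0 ?powR_gt0.
  set D := E t * _ in D0.
  have -> : w t x e ^+ 2 * (E t * (- a * (- (a - 1) * r `^ (a - 1 - 1)))) =
    D * - (w t x e ^+ 2 * (a * (1 - a))) by rewrite /D; ring.
  have -> : r ^+ 2 * r `^ (a - 1 - 1) * (C * (- beta0 * expR (- beta0 * t))) =
    D * - (beta0 * r ^+ 2) by rewrite /D /E; ring.
  rewrite ltr_pM2l// ltrN2.
  apply: (@lt_le_trans _ _ (b ^+ 2 * r ^+ 2 * (a * (1 - a)))).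
    rewrite (_ : b ^+ 2 * r ^+ 2 * (a * (1 - a)) =
      b ^+ 2 * a * (1 - a) * r ^+ 2); last by ring.
    by rewrite ltr_pM2r// exprn_gt0.
  by rewrite ler_wpM2r// mulr_ge0//; lra.
Qed.

End BarrierBounds.

(** * Consequences of the data conditions *)

Section Data.
Context {R : realType}.
Implicit Types (t x y e s : R).

Lemma derive_within_ext (A : set R) (g h : R -> R) (a : R) :
  A a -> (forall s, A s -> g s = h s) ->
    derive_within A g a = derive_within A h a.
Proof.
move=> Aa gh; rewrite /derive_within; congr (lim _).
apply/seteqP; split; apply: near_eq_cvg; near=> s;
  by (have As : A s by near: s; exact: withinT); rewrite !gh.
Unshelve. all: by end_near. Qed.

(** The constant A in w <= A (1 - eta)^a, for boundary values w subject to the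
    upper data bound. *)
Definition tail_const (c0 mu a : R) : R :=
  c0^-1 * (mu `^ (a - 1) / Num.sqrt (2 * (1 - a))).

Lemma tail_const_gt0 (c0 mu a : R) : 0 < c0 -> 0 < mu -> a < 1 ->
  0 < tail_const c0 mu a.
Proof.
move=> c00 mu0 a1; rewrite mulr_gt0 ?invr_gt0// divr_gt0 ?powR_gt0// sqrtr_gt0;
  lra.
Qed.

(** The square of the claim, divided by the common factors, is
    - 2 (1 - a) ln (mu s) <= (mu s)^(- 2 (1 - a)), that is, ln z <= z. *)
Lemma log_weight_le_powR (c0 mu a s : R) : 0 < c0 -> 0 < mu -> 0 < a < 1 ->
  0 < s ->
  c0^-1 * s * Num.sqrt (- ln (mu * s)) <= tail_const c0 mu a * s `^ a.
Proof.
move=> c00 mu0 /andP[a0 a1] s0; pose m := mu * s.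
have m0 : 0 < m by rewrite mulr_gt0.
have a2 : 0 < 2 * (1 - a) by lra.
have sq : 0 < Num.sqrt (2 * (1 - a)) by rewrite sqrtr_gt0.
have L : Num.sqrt (- ln m) <= m `^ (a - 1) / Num.sqrt (2 * (1 - a)).
  have r0 : 0 <= m `^ (a - 1) / Num.sqrt (2 * (1 - a)).
    by rewrite divr_ge0 ?powR_ge0// ltW.
  rewrite -[leRHS](ger0_norm r0) -sqrtr_sqr; apply: ler_wsqrtr.
  rewrite exprMn exprVn (sqr_sqrtr (ltW a2)).
  rewrite ler_pdivlMr// -powR_mulrn ?powR_ge0// -powRrM.
  have := ln_sublinear (powR_gt0 ((a - 1) * 2%:R) m0).
  by rewrite ln_powR; lra.
rewrite /tail_const -mulrA -mulrA ler_wpM2l ?invr_ge0 ?(ltW c00)//.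
apply: (le_trans (ler_wpM2l (ltW s0) L)).
rewrite /m (powRM _ (ltW mu0) (ltW s0)) -(@mulr_powRB1 _ s a (ltW s0) a0).
rewrite [leLHS](_ : _ =
  mu `^ (a - 1) / Num.sqrt (2 * (1 - a)) * (s * s `^ (a - 1))) //.
by ring.
Qed.

End Data.

Section Boundary.
Context {R : realType} (X c0 mu a C1 : R).
Context (X0 : 0 < X) (c01 : 0 < c0 < 1) (mu01 : 0 < mu < 100^-1)
  (a01 : 0 < a < 1).
Context (u0 u1 : R -> R -> R) (u : R -> R -> R -> R) (w0 w1 : R -> R -> R)
  (w : R -> R -> R -> R).
Implicit Types (t x y e s : R).
Context (OS : oleinik_solution X u0 u1 u w0 w1 w).

Lemma shear_inflow t y : 0 <= t -> 0 <= y -> dy u1 t y = w t 0 (u t 0 y).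
Proof.
move=> t0 y0; have x0 : 0 <= (0 : R) <= X by rewrite lexx ltW.
rewrite (oleinik_transform OS t0 x0 y0); apply: derive_within_ext.
  by rewrite /Rge0 /= in_itv/= andbT.
move=> s; rewrite /Rge0 /= in_itv/= andbT => s0.
by have [v P] := oleinik_prandtl OS; rewrite (prandtl_inflow P).
Qed.

Lemma shear_initial x y : 0 <= x <= X -> 0 <= y -> dy u0 x y = w 0 x (u 0 x y).
Proof.
move=> xX y0; rewrite (oleinik_transform OS (lexx 0) xX y0);
  apply: derive_within_ext.
  by rewrite /Rge0 /= in_itv/= andbT.
move=> s; rewrite /Rge0 /= in_itv/= andbT => s0.
by have [v P] := oleinik_prandtl OS; rewrite (prandtl_initial P).
Qed.

Lemma shear_continuous :
  continuous_box Rge0 `[0, X] Rge0 (fun t x y => w t x (u t x y)).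
Proof.
have [v P] := oleinik_prandtl OS.
have /continuous_boxP uc := prandtl_u_cont P.
have /continuous_boxP wc := pcs_cont (oleinik_positive_crocco OS).
apply/continuous_boxP => t x y tE xE yE eps eps0.
have uI (t' x' y' : R) : Rge0 t' -> `[0, X]%classic x' -> Rge0 y' ->
  `[0, 1]%classic (u t' x' y').
  rewrite /Rge0 /= !in_itv/= !andbT => t0 xX y0.
  by rewrite (oleinik_u_ge0 OS)// ltW// (oleinik_u_lt1 OS).
have [d d0 Hd] := wc t x (u t x y) tE xE (uI _ _ _ tE xE yE) eps eps0.
have [d' d'0 Hd'] := uc t x y tE xE yE d d0.
exists (Num.min d d'); first by rewrite lt_min d0.
move=> t' x' y' t'E x'E y'E;
  rewrite !lt_min => /andP[td td'] /andP[xd xd'] /andP[_ yd'].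
by apply: Hd => //; [exact: uI|exact: Hd'].
Qed.

Lemma boundary_data_bounds t x e : data_conditions X c0 mu a C1 20 w0 w1 w ->
  0 <= t -> 0 <= x <= X -> 0 <= e < 1 ->
  t = 0 \/ x = 0 -> data_bounds c0 mu e (w t x e).
Proof.
move=> D t0 xX eI; have eI' : 0 <= e <= 1 by case/andP: eI => -> /ltW.
case=> [->|->].
  by rewrite (crocco_initial (oleinik_crocco OS))//; exact: (data_w0 D).
by rewrite (crocco_inflow (oleinik_crocco OS))//; exact: (data_w1 D).
Qed.

Lemma boundary_upper t x e : data_conditions X c0 mu a C1 20 w0 w1 w ->
  0 <= t -> 0 <= x <= X -> 0 <= e < 1 ->
  t = 0 \/ x = 0 -> w t x e <= tail_const c0 mu a * (1 - e) `^ a.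
Proof.
move=> /boundary_data_bounds bd t0 xX eI tx;
  have /andP[_ h] := bd _ _ _ t0 xX eI tx.
have /andP[c00 _] := c01; have /andP[mu0 _] := mu01.
by apply: (le_trans h); apply: log_weight_le_powR => //; lra.
Qed.

Lemma bconst_gt0 : 0 < bconst X c0 20.
Proof. by have /andP[c00 _] := c01; rewrite /bconst !mulr_gt0 ?expR_gt0//;
  lra. Qed.

(** The barrier is at least c0 e^(-20 X) (1 - eta) / 10, and
    e^(-8/3) / 4 <= 1 / 10 follows from e^(8/3) >= 1 + 8/3. *)
Lemma bconst_lower t x e : data_conditions X c0 mu a C1 20 w0 w1 w ->
  0 <= t -> 0 <= x <= X -> 0 <= e < 1 ->
  bconst X c0 20 * (1 - e) <= w t x e.
Proof.
move=> /boundary_data_bounds bd t0 xX eI.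
have W := oleinik_positive_crocco OS; have cI := c01.
apply: le_trans (crocco_lower_bound (c := c0) W _ _ t0 xX eI); last first.
- move=> t' x' e' t'0 x'X e'I tx.
  by have /andP[] := bd _ _ _ t'0 x'X e'I tx.
- lra.
have /andP[k0 _] : (1 - e) / 10 <= lower_profile e <= 1 - e.
  by apply: lower_profile_bounds; lra.
have E1 : expR (- (20 * X)) <= expR (- 20 * x) by rewrite ler_expR; lra.
have E2 : expR (- (8 / 3)) <= (2 / 5 : R).
  rewrite expRN -[leLHS]mul1r ler_pdivrMr ?expR_gt0//.
  by have := expR_ge1Dx (8 / 3 : R); lra.
rewrite /bconst.
apply: (@le_trans _ _ (c0 * expR (- 20 * x) * ((1 - e) / 10))); last first.
  by rewrite ler_wpM2l// mulr_ge0 ?expR_ge0//; lra.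
rewrite [leLHS](_ : _ =
  c0 * (1 - e) / 4 * (expR (- (20 * X)) * expR (- (8 / 3)))); last by ring.
rewrite [leRHS](_ : _ = c0 * (1 - e) / 4 * (expR (- 20 * x) * (2 / 5)));
  last by field.
have ce : 0 <= c0 * (1 - e) by rewrite mulr_ge0//; lra.
by rewrite ler_wpM2l//; [lra|rewrite ler_pM ?expR_ge0].
Qed.

End Boundary.

(** * Uniform estimates *)

Section Thresholds.
Context {R : realType}.

(** The cut-off distance k to eta = 1 depends on sigma only; then d is small
    depending on k. *)
Lemma orbital_thresholds (a b A sigma : R) : 0 < a -> 0 < b -> 0 < A ->
  0 < sigma ->
  exists k d : R, [/\ 0 < k < 1, 0 < d, A * k `^ a <= sigma,
    d * (- ln k / b) <= k / 2 & d + 4 * A / k * (d * (- ln k / b)) <= sigma].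
Proof.
move=> a0 b0 A0 s0; pose k := Num.min (1 / 2) ((sigma / A) `^ a^-1).
have k0 : 0 < k by rewrite lt_min powR_gt0 ?divr_gt0//; lra.
have k12 : k <= 1 / 2 by rewrite ge_min lexx.
have kA : A * k `^ a <= sigma.
  rewrite mulrC -ler_pdivlMr//.
  have sA : 0 < sigma / A by rewrite divr_gt0.
  rewrite -[leRHS]powRr1 ?(ltW sA)// -(mulVf (lt0r_neq0 a0)) powRrM.
  by rewrite ge0_ler_powR ?nnegrE ?powR_ge0 ?(ltW a0) ?(ltW k0)// ge_min lexx
    orbT.
pose Y := - ln k / b.
have Y0 : 0 < Y by rewrite divr_gt0// oppr_gt0 ln_lt0//; lra.
have K0 : 0 < 1 + 4 * A / k * Y.
  by rewrite ltr_wpDr// mulr_ge0 ?(ltW Y0)// divr_ge0 ?mulr_ge0//; exact: ltW.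
exists k, (Num.min (k / 2 / Y) (sigma / (1 + 4 * A / k * Y))); split => //.
- lra.
- by rewrite lt_min; apply/andP; split; apply: divr_gt0 => //; lra.
- by rewrite -ler_pdivlMr// ge_min lexx.
- rewrite -/Y; set d := Num.min _ _.
  have -> : d + 4 * A / k * (d * Y) = d * (1 + 4 * A / k * Y) by ring.
  by rewrite -ler_pdivlMr// ge_min lexx orbT.
Qed.

End Thresholds.

Section Comparison.
Context {R : realType} (X : R).
Implicit Types (t x y e : R) (w q u p : R -> R -> R -> R).

(** For y <= Y = (1 + |ln eps|) / b the difference is at most sigma Y = eps; for
    y >= Y both profiles lie within e^(-b y) <= eps of the outer flow. *)
Lemma profile_difference_uniform (b eps : R) : 0 < b -> 0 < eps ->
  exists2 sigma : R, 0 < sigma &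
  forall (u0 u1 : R -> R -> R) u (w0 w1 : R -> R -> R) w
    (p0 p1 : R -> R -> R) p (q0 q1 : R -> R -> R) q,
    oleinik_solution X u0 u1 u w0 w1 w -> oleinik_solution X p0 p1 p q0 q1 q ->
    (forall t x e, 0 <= t -> 0 <= x <= X -> 0 <= e < 1 ->
      b * (1 - e) <= w t x e) ->
    (forall t x e, 0 <= t -> 0 <= x <= X -> 0 <= e < 1 ->
      b * (1 - e) <= q t x e) ->
    (forall t x e, 0 <= t -> 0 <= x <= X -> 0 <= e < 1 ->
       pderiv3 `[0, 1[ (pderiv3 `[0, 1[ q) t x e <= 0) ->
    forall t x, 0 <= t -> 0 <= x <= X ->
      (forall e, 0 <= e < 1 -> `|w t x e - q t x e| <= sigma) ->
      forall y, 0 <= y -> `|u t x y - p t x y| <= eps.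
Proof.
move=> b0 eps0; pose Y := (1 + `|ln eps|) / b.
have Y0 : 0 < Y by rewrite divr_gt0// ltr_wpDr.
exists (eps / Y); first exact: divr_gt0.
move=> u0 u1 u w0 w1 w p0 p1 p q0 q1 q OS OSp wb qb qcc t x t0 xX H y y0.
have [yY|Yy] := leP y Y.
  apply: (le_trans (profile_difference OS OSp qcc t0 xX y0 H)).
  by rewrite mulrAC ler_pdivrMr// ler_wpM2l// ltW.
have E : expR (- b * y) <= eps.
  rewrite -[leRHS]lnK ?posrE// ler_expR.
  have : b * Y <= b * y by rewrite ler_pM2l// ltW.
  rewrite /Y mulrC divfK ?gt_eqF// => h.
  by have := ler_norm (- ln eps); rewrite normrN; lra.
have := outer_flow_tail OS t0 xX y0 b0 (fun e eI => wb t x e t0 xX eI).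
have := outer_flow_tail OSp t0 xX y0 b0 (fun e eI => qb t x e t0 xX eI).
have := oleinik_u_lt1 OS t0 xX y0; have := oleinik_u_lt1 OSp t0 xX y0.
by rewrite ler_norml; lra.
Qed.

End Comparison.

Section ShearHypothesis.
Context {R : realType} (X : R) (X0 : 0 < X).
Context (u0 u1 : R -> R -> R) (u : R -> R -> R -> R) (w0 w1 : R -> R -> R)
  (w : R -> R -> R -> R).
Context (p0 p1 : R -> R -> R) (p : R -> R -> R -> R) (q0 q1 : R -> R -> R)
  (q : R -> R -> R -> R).
Context (OS : oleinik_solution X u0 u1 u w0 w1 w).
Context (OSp : oleinik_solution X p0 p1 p q0 q1 q).
Implicit Types (t x y e d : R).

Let shear_difference_continuous :=
  continuous_boxB (shear_continuous OS) (shear_continuous OSp).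

Lemma shear_close_inflow d :
  (Linfty2 Rge0 Rge0 (fun t y => (dy u1 t y - dy p1 t y)%R) <= d%:E)%E ->
  forall t y, 0 <= t -> 0 <= y -> `|w t 0 (u t 0 y) - q t 0 (p t 0 y)| <= d.
Proof.
have toP z : Rge0 z -> 0 <= z by rewrite /Rge0 /= in_itv/= andbT.
have ofP z : 0 <= z -> Rge0 z by rewrite /Rge0 /= in_itv/= andbT.
have x0 : `[0, X]%classic 0 by rewrite /= in_itv/= lexx ltW.
move=> H t y t0 y0; rewrite -(shear_inflow X0 OS)// -(shear_inflow X0 OSp)//.
apply: (Linfty2_pointwise _ _ _ H);
  [exact: thick_Rge0|exact: thick_Rge0| |exact: ofP|exact: ofP].
move=> a b Aa Bb eps eps0.
have /continuous_boxP K := shear_difference_continuous.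
have [r r0 Hr] := K a 0 b Aa x0 Bb eps eps0; exists r => // a' b' Aa' Bb' aa bb.
rewrite !(shear_inflow X0 OS) ?(shear_inflow X0 OSp); [|exact: toP..].
by apply: Hr; rewrite // subrr normr0.
Qed.

Lemma shear_close_initial d :
  (Linfty2 `[0%R, X] Rge0 (fun x y => (dy u0 x y - dy p0 x y)%R) <= d%:E)%E ->
  forall x y, 0 <= x <= X -> 0 <= y ->
    `|w 0 x (u 0 x y) - q 0 x (p 0 x y)| <= d.
Proof.
have toP z : Rge0 z -> 0 <= z by rewrite /Rge0 /= in_itv/= andbT.
have ofP z : 0 <= z -> Rge0 z by rewrite /Rge0 /= in_itv/= andbT.
have toX z : `[0, X]%classic z -> 0 <= z <= X by rewrite /= in_itv.
have ofX z : 0 <= z <= X -> `[0, X]%classic z by rewrite /= in_itv.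
have t0 : Rge0 (0 : R) by apply: ofP.
move=> H x y xX y0; rewrite -(shear_initial OS)// -(shear_initial OSp)//.
apply: (Linfty2_pointwise _ _ _ H);
  [exact: thick_itv|exact: thick_Rge0| |exact: ofX|exact: ofP].
move=> a b Aa Bb eps eps0.
have /continuous_boxP K := shear_difference_continuous.
have [r r0 Hr] := K 0 a b t0 Aa Bb eps eps0; exists r => // a' b' Aa' Bb' aa bb.
have [XA XA' YB YB'] : [/\ 0 <= a <= X, 0 <= a' <= X, 0 <= b & 0 <= b'].
  by split; [exact: toX|exact: toX|exact: toP|exact: toP].
rewrite !(shear_initial OS) ?(shear_initial OSp)//.
by apply: Hr; rewrite // subrr normr0.
Qed.

Lemma yinvK t e : 0 <= t -> 0 <= e < 1 ->
  0 <= yinv u1 t e /\ u t 0 (yinv u1 t e) = e.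
Proof.
move=> t0 eI; have x0 : 0 <= (0 : R) <= X by rewrite lexx ltW.
have [v P] := oleinik_prandtl OS.
have [y y0 uy] := oleinik_u_onto OS t0 x0 eI.
have [yi ye] : [set z | 0 <= z /\ u1 t z = e] (yinv u1 t e).
  by apply: getPex; exists y; split => //; rewrite -(prandtl_inflow P).
by split=> //; rewrite (prandtl_inflow P).
Qed.

End ShearHypothesis.

(** * Stability *)

Theorem theorem1p2 (R : realType) (X c0 mu : R) (hX : 0 < X)
    (hc0 : 0 < c0 < 1) (hmu : 0 < mu < 100^-1) :
  exists beta : R, 0 < beta /\
  forall (alpha0 C1 : R), 0 < alpha0 < 1 -> 0 < C1 ->
  (* (i) orbital stability *)
  (forall eps : R, 0 < eps ->
   exists delta_eps : R, 0 < delta_eps /\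
   forall (ubar0 ubar1 ubar wbar0 wbar1 : R -> R -> R) (wbar : R -> R -> R -> R)
          (u0 u1 : R -> R -> R) (u : R -> R -> R -> R)
          (w0 w1 : R -> R -> R) (w : R -> R -> R -> R),
     stability_setting X c0 mu alpha0 C1 beta
       ubar0 ubar1 ubar wbar0 wbar1 wbar u0 u1 u w0 w1 w ->
     (Linfty2 Rge0 Rge0 (fun t y => (dy u1 t y - dy ubar1 t y)%R)
        <= delta_eps%:E)%E ->
     (Linfty2 `[0%R, X] Rge0 (fun x y => (dy u0 x y - dy ubar0 x y)%R)
        <= delta_eps%:E)%E ->
     (Linfty3 Rge0 `[0%R, X] Rge0 (fun t x y => (ubar x y - u t x y)%R)
        <= eps%:E)%E) /\
  (* (ii) asymptotic stability *)
  (forall (ubar0 ubar1 ubar wbar0 wbar1 : R -> R -> R) (wbar : R -> R -> R -> R)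
          (u0 u1 : R -> R -> R) (u : R -> R -> R -> R)
          (w0 w1 : R -> R -> R) (w : R -> R -> R -> R),
     stability_setting X c0 mu alpha0 C1 beta
       ubar0 ubar1 ubar wbar0 wbar1 wbar u0 u1 u w0 w1 w ->
   forall beta0 C2 : R,
     0 < beta0 < bconst X c0 beta ^+ 2 * alpha0 * (1 - alpha0) -> 0 < C2 ->
     (forall t eta : R, 0 <= t -> 0 <= eta < 1 ->
        `| dy u1 t (yinv u1 t eta) - dy ubar1 t (yinv ubar1 t eta) |
          <= expR (- (t * beta0)) * C2 * (1 - eta) `^ alpha0) ->
     (forall y0 : R, 0 < y0 ->
      exists C : R, 0 < C /\
      forall t : R, 0 <= t ->
        (Linfty2 `[0%R, X] `[0%R, y0] (fun x y => (u t x y - ubar x y)%R)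
           <= (C * expR (- (t * beta0)))%R%:E)%E) /\
     ((Linfty2 `[0%R, X] Rge0 (fun x y => (u t x y - ubar x y)%R))
        @[t --> +oo] --> 0%E)).
Proof.
have c00 : 0 < c0 by case/andP: hc0.
have mu0 : 0 < mu by case/andP: hmu.
(* The exponential rate in x of the barrier of [crocco_lower_bound]. *)
exists 20; split=> // a C1 ha hC1.
have a1 : a < 1 by case/andP: ha.
have a0 : 0 < a by case/andP: ha.
pose b := bconst X c0 20; pose A := tail_const c0 mu a.
have b0 : 0 < b by exact: bconst_gt0.
have A0 : 0 < A by exact: tail_const_gt0.
have ofX (z : R) : `[0, X]%classic z -> 0 <= z <= X by rewrite /= in_itv.
have ofP (z : R) : Rge0 z -> 0 <= z by rewrite /Rge0 /= in_itv/= andbT.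
split.
  move=> eps eps0.
  have [sigma s0 Hs] := profile_difference_uniform X b0 eps0.
  have [k [d [k01 d0 kA dk ds]]] := orbital_thresholds a0 b0 A0 s0.
  exists d; split=> // ubar0 ubar1 ubar wbar0 wbar1 wbar u0 u1 u w0 w1 w.
  move=> [OSp OS qcc Dp Dw] H1 H0.
  have W := oleinik_positive_crocco OS; have V := oleinik_positive_crocco OSp.
  have wb := bconst_lower hc0 OS Dw; have qb := bconst_lower hc0 OSp Dp.
  have wA := boundary_upper hc0 hmu ha OS Dw.
  have qA := boundary_upper hc0 hmu ha OSp Dp.
  have close (t x e : R) : 0 <= t -> 0 <= x <= X -> 0 <= e < 1 ->
    `|w t x e - wbar t x e| <= sigma.
    apply: (crocco_difference_sup W V qcc) => {t x e} t x e t0 xX eI tx.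
    apply: (crocco_close_of_shear_close (b := b) (k := k) (d := d) (M := A)
      OS OSp qcc t0 xX) => //.
    - exact: ltW.
    - by move=> e' e'I; exact: wb.
    - move=> e' e'I; have e'J : 0 <= e' < 1 by lra.
      have T : A * (1 - e') `^ a <= sigma.
        apply: le_trans kA; rewrite ler_wpM2l ?(ltW A0)//.
        by clear -e'I k01 a0; apply: ge0_ler_powR; rewrite ?nnegrE; lra.
      by split; apply: le_trans T; [exact: wA|exact: qA].
    - have := qA t x 0 t0 xX; rewrite subr0 powR1 mulr1; apply => //.
      by rewrite lexx ltr01.
    - move=> y y0; case: tx => [t_0|x_0].
        by rewrite t_0; apply: (shear_close_initial hX OS OSp H0).
      by rewrite x_0; apply: (shear_close_inflow hX OS OSp H1).
  apply: Linfty3_le; first exact: ltW.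
  move=> t x y /ofP t0 /ofX xX /ofP y0; rewrite distrC.
  apply: (Hs _ _ _ _ _ _ _ _ _ _ _ _ OS OSp wb qb qcc t x t0 xX _ y y0) => e eI.
  exact: close.
move=> ubar0 ubar1 ubar wbar0 wbar1 wbar u0 u1 u w0 w1 w [OSp OS qcc Dp Dw].
move=> beta0 C2 /andP[beta00 hbeta] C20 H.
have W := oleinik_positive_crocco OS; have V := oleinik_positive_crocco OSp.
have wb := bconst_lower hc0 OS Dw; have qb := bconst_lower hc0 OSp Dp.
have wA := boundary_upper hc0 hmu ha OS Dw.
have qA := boundary_upper hc0 hmu ha OSp Dp.
(* The inflow difference is bounded through C2 by assumption; at t = 0 both
   transforms lie between 0 and A (1 - eta)^alpha0. *)
pose C := C2 + A; have C0 : 0 < C by rewrite addr_gt0.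
have decay (t x e : R) : 0 <= t -> 0 <= x <= X -> 0 <= e < 1 ->
    `|w t x e - wbar t x e| <= C * expR (- beta0 * t) * (1 - e) `^ a.
  apply: (crocco_difference_decay W V ha b0 hbeta C0 wb qcc) =>
    {t x e} t x e t0 xX eI tx.
  have p0 := powR_ge0 (1 - e) a.
  case: tx => [t_0|x_0].
    have := wA t x e t0 xX eI (or_introl t_0).
    have := qA t x e t0 xX eI (or_introl t_0).
    have := pcs_gt0 W t0 xX eI; have := pcs_gt0 V t0 xX eI.
    rewrite t_0 mulr0 expR0 mulr1 ler_norml -/A /C.
    have : 0 <= C2 * (1 - e) `^ a by rewrite mulr_ge0// ltW.
    lra.
  have := H t e t0 eI.
  have [y0 uy] := yinvK hX OS t0 eI; have [y0' uy'] := yinvK hX OSp t0 eI.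
  rewrite (shear_inflow hX OS)// (shear_inflow hX OSp)// uy uy' x_0.
  move=> /le_trans; apply; rewrite ler_wpM2r//.
  rewrite mulrC (mulrC t) -mulNr ler_wpM2r ?expR_ge0// /C lerDl ltW//.
have small (t x e : R) : 0 <= t -> 0 <= x <= X -> 0 <= e < 1 ->
    `|w t x e - wbar t x e| <= C * expR (- (t * beta0)).
  move=> t0 xX eI; apply: (le_trans (decay t x e t0 xX eI)).
  rewrite mulNr (mulrC beta0) ler_piMr//;
    first by rewrite mulr_ge0 ?expR_ge0// ltW.
  apply: (@le_trans _ _ (1 `^ a)); last by rewrite powR1.
  by clear -eI a0; apply: ge0_ler_powR; rewrite ?nnegrE; lra.
split.
  move=> y0 hy0; exists (C * y0); split; first exact: mulr_gt0.
  move=> t t0; have E0 := expR_ge0 (- (t * beta0)).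
  apply: Linfty2_le; first by rewrite !mulr_ge0// ltW.
  move=> x y /ofX xX; rewrite /= in_itv/= => /andP[yy0 yY].
  apply: (le_trans (profile_difference OS OSp qcc t0 xX yy0 (fun e eI =>
    small t x e t0 xX eI))).
  by rewrite (mulrAC C y0) ler_wpM2l// mulr_ge0// ltW.
apply: ereal_cvg0; first by move=> t; exact: Lnorm_ge0.
move=> eps eps0; have [sigma s0 Hs] := profile_difference_uniform X b0 eps0.
(* From this time on C e^(- beta0 t) <= sigma. *)
exists (Num.max 0 (- ln (sigma / C) / beta0)) => t;
  rewrite ge_max => /andP[t0 tT].
apply: Linfty2_le; first exact: ltW.
move=> x y /ofX xX /ofP y0.
apply: (Hs _ _ _ _ _ _ _ _ _ _ _ _ OS OSp wb qb qcc t x t0 xX _ y y0) => e eI.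
apply: (le_trans (small t x e t0 xX eI)).
rewrite mulrC -ler_pdivlMr// -[leRHS]lnK ?posrE ?divr_gt0// ler_expR.
by move: tT; rewrite ler_pdivrMr//; lra.
Qed.
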